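(* Let $\boldsymbol{\gamma}=(\gamma_1,\gamma_2,\ldots)$ be a sequence of real weights with $\gamma_1\ge\gamma_2\ge\cdots>0$. Let $N,s,d$ be positive integers with $d<s$ and let $\alpha>1/2$ be a real number. Assume that there exists $0<\lambda^*<1$ such that $$\sum_{j=1}^{\infty}\gamma_j^{\lambda^*}<\infty.$$ Let $\boldsymbol{z}\in\{1,\ldots,N-1\}^d$ be constructed by the (fast) component-by-component algorithm with the quality criterion $(e^{\mathrm{wor}}(H_{d,\alpha,\boldsymbol{\gamma}},P_{N,d,\boldsymbol{z}}))^2$. Then the mean squared worst-case error of the equally-weighted quadrature rule using the concatenated point set $P_{N,s,d,\boldsymbol{z}}$ for the weighted Korobov space $H_{s,\alpha,\boldsymbol{\gamma}}$ is bounded above by $$\mathbb{E}\left[(e^{\mathrm{wor}}(H_{s,\alpha,\boldsymbol{\gamma}},P_{N,s,d,\boldsymbol{z}}))^2\right]\le\left[\frac{1}{\varphi(N)}\left(-1+\exp\left(2C^{\lambda}\zeta(2\alpha\lambda)\zeta(\lambda/\lambda^* )\right)\right)\right]^{1/\lambda}+\frac{\exp\left(2C\zeta(2\alpha)\zeta(1/\lambda^* )\right)}{N d^{1/\lambda^*-1}}\left[-1+\exp\left(\frac{2C\zeta(2\alpha)}{1/\lambda^*-1}\right)\right],$$ for any $\lambda\in(\max(\lambda^*,1/(2\alpha)),1]$, where $C>0$ is a constant depending only on $\boldsymbol{\gamma}$, and $\varphi$ and $\zeta$ denote the Euler totient function and the Riemann zeta function, respectively.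
   Context: Weighted Korobov space. Let $\alpha>1/2$ and let $\boldsymbol{\gamma}=(\gamma_1,\gamma_2,\ldots)$ be a non-increasing sequence of positive real weights. For a positive integer $s$ and $\boldsymbol{h}\in\mathbb{Z}^s$ put $r_{\alpha,\boldsymbol{\gamma}}(\boldsymbol{h})=\prod_{1\le j\le s,\,h_j\ne 0}\gamma_j/|h_j|^{2\alpha}$ (empty product $=1$). For periodic $f:[0,1)^s\to\mathbb{R}$ with absolutely convergent Fourier series $f(\boldsymbol{x})=\sum_{\boldsymbol{h}\in\mathbb{Z}^s}\hat f(\boldsymbol{h})\exp(2\pi i\,\boldsymbol{h}\cdot\boldsymbol{x})$, $\hat f(\boldsymbol{h})=\int_{[0,1)^s}f(\boldsymbol{x})\exp(-2\pi i\,\boldsymbol{h}\cdot\boldsymbol{x})\,d\boldsymbol{x}$, the space $H_{s,\alpha,\boldsymbol{\gamma}}$ is the reproducing kernel Hilbert space of such functions with inner product $\langle f,g\rangle_{s,\alpha,\boldsymbol{\gamma}}=\hat f(\boldsymbol{0})\overline{\hat g(\boldsymbol{0})}+\sum_{\boldsymbol{h}\in\mathbb{Z}^s\setminus\{\boldsymbol{0}\}}\hat f(\boldsymbol{h})\overline{\hat g(\boldsymbol{h})}/r_{\alpha,\boldsymbol{\gamma}}(\boldsymbol{h})$, norm $\|\cdot\|_{s,\alpha,\boldsymbol{\gamma}}$, and reproducing kernel $K_{s,\alpha,\boldsymbol{\gamma}}(\boldsymbol{x},\boldsymbol{y})=1+\sum_{\boldsymbol{h}\in\mathbb{Z}^s\setminus\{\boldsymbol{0}\}}r_{\alpha,\boldsymbol{\gamma}}(\boldsymbol{h})\exp(2\pi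 i\,\boldsymbol{h}\cdot(\boldsymbol{x}-\boldsymbol{y}))$. Worst-case error. For a finite point set $P\subset[0,1)^s$ (points counted with multiplicity; the sets below are indexed by $n=0,\ldots,N-1$ and $|P|=N$), let $I(f;P)=\frac{1}{|P|}\sum_{\boldsymbol{x}\in P}f(\boldsymbol{x})$ be the equally-weighted quadrature rule and $I(f)=\int_{[0,1)^s}f(\boldsymbol{x})\,d\boldsymbol{x}$. The worst-case error is $e^{\mathrm{wor}}(H_{s,\alpha,\boldsymbol{\gamma}},P)=\sup\{|I(f;P)-I(f)|: f\in H_{s,\alpha,\boldsymbol{\gamma}},\ \|f\|_{s,\alpha,\boldsymbol{\gamma}}\le 1\}$. Point sets. $\{x\}=x-\lfloor x\rfloor$ is the fractional part of a real number $x$. For $\boldsymbol{z}\in\{1,\ldots,N-1\}^d$, the rank-1 lattice point set is $P_{N,d,\boldsymbol{z}}=\{(\{nz_1/N\},\ldots,\{nz_d/N\}):0\le n\le N-1\}\subset[0,1)^d$. The concatenated point set is $P_{N,s,d,\boldsymbol{z}}=\{(\{nz_1/N\},\ldots,\{nz_d/N\},x_{n,d+1},\ldots,x_{n,s}):0\le n\le N-1\}\subset[0,1)^s$, where $x_{n,j}$ ($0\le n\le N-1$, $d+1\le j\le s$) are independent random variables uniformly distributed on $[0,1)$; $\mathbb{E}$ denotes expectation with respect to these random variables. Component-by-component algorithm. Set $z_1=1$; then for $j=2,3,\ldots,d$ successively, keeping $z_1,\ldots,z_{j-1}$ fixed, choose $z_j$ to be a minimizer over $z\in\{1,\ldots,N-1\}$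 of $(e^{\mathrm{wor}}(H_{j,\alpha,\boldsymbol{\gamma}},P_{N,j,(z_1,\ldots,z_{j-1},z)}))^2$. (The ''fast'' version is an implementation of the same algorithm.)
   Formalization: The constant C is allowed to depend on the exponent λ* of the summability assumption as well as on γ; with C depending on γ alone, uniformly in λ*, the bound fails (e.g. γ_j = 2^{-j}, α = 2, λ = 1/2, λ* → 0, N a large prime). *)

(* Defs.v *)
From HB Require Import structures.
From mathcomp Require Import all_boot all_order all_algebra finmap.
From mathcomp Require Import complex.
From mathcomp Require Import all_classical all_reals all_analysis.
From mathcomp Require summability.

Set Implicit Arguments.
Unset Strict Implicit.
Unset Printing Implicit Defensive.
Import Order.TTheory GRing.Theory Num.Theory.
Import numFieldNormedType.Exports.

Local Open Scope classical_set_scope.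
Local Open Scope ring_scope.
Local Open Scope complex_scope.

(* Lebesgue measure on R^s, with R^s modelled by s.-tuple R: it is built by
   recursion on s, as the image of lebesgue_measure \x (measure on R^s) by
   (t, x) |-> t :: x. *)
Section lebesgue_tuple.
Context {R : realType}.

Definition cons_pair n (p : R * n.-tuple R) : n.+1.-tuple R :=
  [tuple of p.1 :: p.2].

Definition uncons_pair n (x : n.+1.-tuple R) : R * n.-tuple R :=
  (thead x, [tuple of behead x]).

Lemma measurable_cons_pair n : measurable_fun setT (@cons_pair n).
Proof. exact: measurable_cons. Qed.

Lemma measurable_uncons_pair n : measurable_fun setT (@uncons_pair n).
Proof.
apply/measurable_fun_pairP; split; first exact: measurable_tnth.
exact: measurable_behead.
Qed.

Lemma uncons_pairK n : cancel (@uncons_pair n) (@cons_pair n).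
Proof. by move=> x; rewrite /cons_pair/= -tuple_eta. Qed.

Lemma cons_pairK n : cancel (@cons_pair n) (@uncons_pair n).
Proof. by move=> [t x]; congr pair; exact: val_inj. Qed.

Section step.
Local Open Scope ereal_scope.
Variables (n : nat) (mu : {sigma_finite_measure set (n.-tuple R) -> \bar R}).

Definition lebesgue_cons : set (n.+1.-tuple R) -> \bar R :=
  pushforward (@lebesgue_measure R \x mu) (@cons_pair n).

Let measurable_preimage_cons (A : set (n.+1.-tuple R)) : measurable A ->
  measurable (@cons_pair n @^-1` A : set (measurableTypeR R * n.-tuple R)).
Proof.
by move=> mA; rewrite -[X in measurable X]setTI; exact: measurable_cons_pair.
Qed.

Let lebesgue_cons0 : lebesgue_cons set0 = 0.
Proof. by rewrite /lebesgue_cons /pushforward preimage_set0 measure0. Qed.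

Let lebesgue_cons_ge0 A : 0 <= lebesgue_cons A.
Proof. exact: (measure_ge0 (@lebesgue_measure R \x mu)). Qed.

Let lebesgue_cons_sigma_additive : semi_sigma_additive lebesgue_cons.
Proof.
move=> F mF tF mUF; rewrite /lebesgue_cons /pushforward preimage_bigcup.
apply: (@measure_semi_sigma_additive _ _ _ (@lebesgue_measure R \x mu)).
- by move=> i; exact: measurable_preimage_cons.
- apply/trivIsetP => /= i j _ _ ij; rewrite -preimage_setI.
  by move/trivIsetP : tF => /(_ _ _ _ _ ij) ->//; rewrite preimage_set0.
- by rewrite -preimage_bigcup; exact: measurable_preimage_cons.
Qed.

HB.instance Definition _ := isMeasure.Build _ _ _ lebesgue_cons
  lebesgue_cons0 lebesgue_cons_ge0 lebesgue_cons_sigma_additive.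

Let lebesgue_cons_sigma_finite : sigma_finite setT lebesgue_cons.
Proof.
have /sigma_finiteP[F [TF ndF Foo]] := sigma_finiteT (@lebesgue_measure R).
have /sigma_finiteP[G [TG ndG Goo]] := sigma_finiteT mu.
exists (fun i => @uncons_pair n @^-1` (F i `*` G i)).
  rewrite -preimage_bigcup -[LHS](preimage_setT (@uncons_pair n)).
  congr (_ @^-1` _).
  rewrite -setXTT TF TG predeqE => -[x y]; split.
    move=> [/= [i _ Fix] [k _ Gky]]; exists (maxn i k) => //; split.
    - by move: x Fix; exact/subsetPset/ndF/leq_maxl.
    - by move: y Gky; exact/subsetPset/ndG/leq_maxr.
  by move=> [i _ []/= ? ?]; split; exists i.
move=> i; have [mF Fi] := Foo i; have [mG Gi] := Goo i; split.
  by rewrite -[X in measurable X]setTI; apply: measurable_uncons_pair => //;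
    exact: measurableX.
rewrite /lebesgue_cons /pushforward -comp_preimage.
rewrite (_ : _ \o _ = id); last by apply/funext => p; exact: cons_pairK.
by rewrite preimage_id product_measure1E// lte_mul_pinfty// ge0_fin_numE.
Qed.

HB.instance Definition _ := Measure_isSigmaFinite.Build _ _ _ lebesgue_cons
  lebesgue_cons_sigma_finite.

End step.

Fixpoint lebesgue_tuple n : {sigma_finite_measure set (n.-tuple R) -> \bar R} :=
  match n with
  | 0 => \d_ ([tuple] : 0.-tuple R)
  | m.+1 => lebesgue_cons (lebesgue_tuple m)
  end.

End lebesgue_tuple.

(* The unordered family u is summable with sum l. Stated for an abstract
   numFieldType, whose topology is inferred, and used below at R[i]. *)
Definition has_sum (K : numFieldType) (I : choiceType) (u : I -> K) (l : K) :=
  summability.partial_sum u @ summability.totally --> l.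

Section korobov.
Context {R : realType}.
Implicit Types (alpha : R) (gamma : nat -> R).

Definition unit_cube s : set (s.-tuple R) :=
  [set x | forall j, 0 <= tnth x j < 1].
Arguments unit_cube : clear implicits.

Definition dot s (h : s.-tuple int) (x : s.-tuple R) : R :=
  \sum_(j < s) (tnth h j)%:~R * tnth x j.

(* exp(2 pi i t) *)
Definition cis2pi (t : R) : R[i] := cos (2 * pi * t) +i* sin (2 * pi * t).

Definition cube_integral s (g : s.-tuple R -> R) : R :=
  \int[lebesgue_tuple s]_(x in unit_cube s) g x.

Definition fourier_coef s (f : s.-tuple R -> R) (h : s.-tuple int) : R[i] :=
  let g x := (f x)%:C * cis2pi (- dot h x) in
  cube_integral (fun x => complex.Re (g x))
    +i* cube_integral (fun x => complex.Im (g x)).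

(* Weights are indexed from 0: gamma j is the weight of the (j+1)-st
   coordinate, the one with index j in 'I_s. *)
Definition decay alpha gamma s (h : s.-tuple int) : R :=
  \prod_(j < s | tnth h j != 0)
    (gamma j / `|(tnth h j)%:~R| `^ (2 * alpha)).

Definition zero_freq s : s.-tuple int := [tuple 0 | _ < s].

(* <f, f> for the inner product of the Korobov space *)
Definition korobov_sqnorm alpha gamma s (f : s.-tuple R -> R) : \bar R :=
  ((Normc.normc (fourier_coef f (zero_freq s)) ^+ 2)%:E +
   \esum_(h in ~` [set zero_freq s])
     (Normc.normc (fourier_coef f h) ^+ 2 / decay alpha gamma h)%:E)%E.

Definition korobov_norm alpha gamma s (f : s.-tuple R -> R) : \bar R :=
  sqrte (korobov_sqnorm alpha gamma f).

(* A function on [0,1)^s is identified with its 1-periodic extension to R^s. *)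
Definition periodic s (f : s.-tuple R -> R) : Prop :=
  forall (x : s.-tuple R) (k : s.-tuple int),
    f [tuple tnth x j + (tnth k j)%:~R | j < s] = f x.

Definition abs_conv_fourier s (f : s.-tuple R -> R) : Prop :=
  [/\ (lebesgue_tuple s).-integrable (unit_cube s) (EFin \o f),
      (\esum_(h in [set: s.-tuple int])
         (Normc.normc (fourier_coef f h))%:E < +oo)%E &
      forall x,
        has_sum (fun h : s.-tuple int => fourier_coef f h * cis2pi (dot h x))
          (f x)%:C].

Definition korobov_space alpha gamma s : set (s.-tuple R -> R) :=
  [set f | [/\ periodic f, abs_conv_fourier f &
               (korobov_norm alpha gamma f < +oo)%E]].
Arguments korobov_space : clear implicits.

(* A point set of N points counted with multiplicity is a family indexed by
   'I_N. *)
Definition quadrature N s (P : 'I_N -> s.-tuple R) (f : s.-tuple R -> R) : R :=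
  N%:R^-1 * \sum_(n < N) f (P n).

Definition worst_case_error alpha gamma N s (P : 'I_N -> s.-tuple R) : \bar R :=
  ereal_sup [set `|quadrature P f - cube_integral f|%:E | f in
    korobov_space alpha gamma s `&`
    [set f | (korobov_norm alpha gamma f <= 1)%E]].

Definition frac (x : R) : R := x - (Num.floor x)%:~R.

Definition lattice_points N d (z : 'I_d -> nat) (n : 'I_N) : d.-tuple R :=
  [tuple frac ((n * z j)%:R / N%:R) | j < d].

(* The coordinates x n j with j < d are not used. *)
Definition concatenated_points N s d (z : 'I_d -> nat) (x : 'I_N -> 'I_s -> R)
    (n : 'I_N) : s.-tuple R :=
  [tuple if insub (val j) is Some i then tnth (lattice_points z n) i
         else x n j | j < s].

(* (z_1, ..., z_j, w) as a generating vector of dimension j + 1 *)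
Definition prefix_with d (z : 'I_d -> nat) (j : 'I_d) (w : nat) (i : 'I_j.+1)
    : nat :=
  if i == ord_max then w else z (widen_ord (ltn_ord j) i).
Arguments prefix_with {d} z j w i.

(* z is a possible output of the component-by-component algorithm (the
   minimizer chosen at each step need not be unique). *)
Definition cbc_vector alpha gamma N d (z : 'I_d -> nat) : Prop :=
  [/\ forall j, (0 < z j < N)%N,
      forall j : 'I_d, j = 0%N :> nat -> z j = 1%N &
      forall j : 'I_d, (0 < j)%N -> forall w, (0 < w < N)%N ->
        (worst_case_error alpha gamma
           (lattice_points (N := N) (prefix_with z j (z j))) ^+ 2 <=
         worst_case_error alpha gamma
           (lattice_points (N := N) (prefix_with z j w)) ^+ 2)%E].

Definition zeta (x : R) : R := limn (series (fun n => n.+1%:R `^ (- x))).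

End korobov.

Section probability.
Context d (T : measurableType d) (R : realType) (P : probability T R).
Implicit Types X : {RV P >-> R}.

Definition uniform01 X : Prop :=
  forall A, measurable A ->
    distribution P X A = uniform_prob (@ltr01 R) A.

(* Mutual independence of the random variables X i, i in D *)
Definition mutually_independent (I : finType) (D : {set I})
    (X : I -> {RV P >-> R}) : Prop :=
  forall (J : {set I}) (A : I -> set R), J \subset D ->
    (forall i, measurable (A i)) ->
    P (\bigcap_(i in [set` J]) (X i @^-1` A i)) =
    (\prod_(i in J) P (X i @^-1` A i))%E.

End probability.

(* Main.v *)
From HB Require Import structures.
From mathcomp Require Import all_boot all_order all_algebra finmap.
From mathcomp Require Import complex.
From mathcomp Require Import all_classical all_reals all_analysis.
From mathcomp Require Import measurable_realfun ring lra.
From mathcomp Require summability.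
Require Import Defs.
Set Implicit Arguments.
Unset Strict Implicit.
Unset Printing Implicit Defensive.
Import Order.TTheory GRing.Theory Num.Theory.
Import numFieldNormedType.Exports.
Local Open Scope classical_set_scope.
Local Open Scope ring_scope.
Local Open Scope complex_scope.

(** By Cauchy-Schwarz, the squared worst-case error of a point set is at most the
    sum over the non-zero frequencies [h] of the decay of [h] times the squared
    modulus of the exponential sum at [h]. Once [h] has a non-zero entry among
    the random coordinates, this squared modulus has mean [1 / N]; otherwise it
    is the indicator of the dual lattice of [z]. Hence the mean is at most the
    squared error of the lattice rule plus [1 / N] times a difference of two
    products. For the lattice part, a step of the algorithm adds to the dual
    sum an increment that is minimal over the units modulo [N]; since
    [(x + y) ^ lambda <= x ^ lambda + y ^ lambda], its [lambda]-th power is at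
    most the average over the units of the increments for the weights
    [gamma ^ lambda] and exponent [2 alpha lambda], and these add up by
    induction. Since the weights decrease and [gamma_j ^ lstar] is summable,
    [gamma_j <= C j ^ (- 1 / lstar)], which bounds all the products by
    exponentials. *)

(** * The zeta function and one-dimensional sums *)

(** The algorithm compares squared worst-case errors, whereas the averaging argument concerns dual
    sums. An upper bound is enough for the concatenated points, but the steps of the algorithm call
    for the exact error of a lattice rule; hence the extremal trigonometric polynomials, whose
    frequency sets have to be symmetric because the space consists of real functions. The minimum
    ranges over [1, ..., N - 1], which contains the units when [1 < N], so it is at most the mean
    over the units; restricting to units is what produces [totient N] and lets a gcd control the
    number of solutions of the congruences. The condition [1 / (2 * alpha) < lambda] makes the sums
    with exponent [2 * alpha * lambda] converge, and [lstar < lambda] does the same for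
    [zeta (lambda / lstar)]. The last term of the bound comes from the product over the first [d]
    coordinates times the tail product minus 1: the tail sum of the weights is proportional to
    [d ^ (1 - 1 / lstar)], a factor at most 1 that convexity of the exponential brings outside. *)

Section zeta_bounds.
Variable R : realType.
Implicit Types (p x y : R).

(** The right-hand side is the integral of [(p - 1) * t ^ (- p)] over [[x, x + 1]], and this
    integrand decreases. No integral is used: after division by [(x + 1) ^ (1 - p)] the claim
    follows from [ln t <= t - 1] and [1 + u <= expR u]. *)
Lemma powR_telescope p x : 1 < p -> 1 <= x ->
  (x + 1) `^ (- p) * (p - 1) <= x `^ (1 - p) - (x + 1) `^ (1 - p).
Proof.
move=> p1 x1; set y := x + 1.
have x0 : 0 < x by rewrite (lt_le_trans _ x1).
have y0 : 0 < y by rewrite /y addr_gt0.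
have -> : y `^ (- p) = y `^ (1 - p) / y.
  by rewrite (powRD _ (r := 1)) ?(gt_eqF y0) ?implybT// powRr1 ?(ltW y0)// mulrAC mulfV ?mul1r// gt_eqF.
have -> : x `^ (1 - p) = y `^ (1 - p) * (x / y) `^ (1 - p).
  by rewrite -powRM ?divr_ge0 ?(ltW x0) ?(ltW y0)// mulrC divfK// gt_eqF.
have q0 : 0 < p - 1 by rewrite subr_gt0.
have A0 : 0 < y `^ (1 - p) by rewrite powR_gt0.
set A := y `^ (1 - p) in A0 *; have -> B : A * B - A = A * (B - 1) by ring.
rewrite -mulrA ler_pM2l//.
rewrite /powR gt_eqF ?divr_gt0//.
have t0 : 0 < x / y by rewrite divr_gt0.
have lnt : ln (x / y) <= x / y - 1.
  have := @le_ln1Dx R (x / y - 1); rewrite [1 + _]addrC subrK; apply.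
  by rewrite ltrBrDr addrC subrr.
have := expR_ge1Dx ((1 - p) * ln (x / y)).
have -> : x / y = 1 - y^-1.
  by apply: (mulIf (lt0r_neq0 y0)); rewrite mulrBl mul1r !mulVf ?gt_eqF// divfK ?gt_eqF // /y addrK.
move: lnt; have -> : x / y = 1 - y^-1.
  by apply: (mulIf (lt0r_neq0 y0)); rewrite mulrBl mul1r !mulVf ?gt_eqF// divfK ?gt_eqF // /y addrK.
move=> lnt; nra.
Qed.

(** Telescoping of [powR_telescope] from [x = d] on. The indices [d] to [s - 1] are those of the
    random coordinates: this is the origin of [d ^ (1 / lstar - 1)] and of the denominator
    [1 / lstar - 1] in the theorem. *)
Lemma sum_powR_tail p (d s : nat) : 1 < p -> (0 < d)%N ->
  \sum_(d <= j < s) j.+1%:R `^ (- p) <= d%:R `^ (1 - p) / (p - 1) :> R.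
Proof.
move=> p1 d0; have q0 : 0 < p - 1 by rewrite subr_gt0.
have [sd|ds] := leqP s d.
  by rewrite big_geq// divr_ge0 ?powR_ge0// ltW.
rewrite ler_pdivlMr// mulr_suml.
apply: (@le_trans _ _ (\sum_(d <= j < s) (j%:R `^ (1 - p) - j.+1%:R `^ (1 - p)))).
  apply: ler_sum_nat => j /andP[dj _]; rewrite -natr1; apply: powR_telescope => //.
  by rewrite ler1n (leq_trans d0).
under eq_bigr do rewrite -opprB.
by rewrite sumrN (telescope_sumr (fun j => j%:R `^ (1 - p)) (ltnW ds)) opprB gerBl powR_ge0.
Qed.

Lemma zeta_cvg p : 1 < p -> cvgn (series (fun n => n.+1%:R `^ (- p) : R)).
Proof.
move=> p1; apply: nondecreasing_is_cvgn.
  by apply: nondecreasing_series => n _ _; exact: powR_ge0.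
exists (1 + 1 / (p - 1)) => _ [n _ <-]; rewrite /series/=.
case: n => [|n]; first by rewrite big_geq// addr_ge0// divr_ge0// subr_ge0 ltW.
rewrite big_ltn// powR1 lerD2l.
by apply: (le_trans (sum_powR_tail _ _ _)) => //; rewrite powR1.
Qed.

Lemma series_le_zeta p n : 1 < p ->
  \sum_(0 <= j < n) j.+1%:R `^ (- p) <= zeta p :> R.
Proof.
move=> p1; apply: (nondecreasing_cvgn_le _ (zeta_cvg p1)).
by apply: nondecreasing_series => k _ _; exact: powR_ge0.
Qed.

Lemma nneseries_zeta p : 1 < p ->
  (\sum_(n <oo) (n.+1%:R `^ (- p) : R)%:E = (zeta p)%:E)%E.
Proof.
move=> p1; rewrite /zeta -EFin_lim; last exact: zeta_cvg.
by congr (limn _); apply/funext => n /=; rewrite /series/= sumEFin.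
Qed.

Lemma zeta_ge0 p : 1 < p -> 0 <= zeta p :> R.
Proof. by move=> p1; have := series_le_zeta 0 p1; rewrite big_geq. Qed.

(* The factors of [decay], with exponent [a] in place of [2 * alpha]. *)
Definition decay1 (a g : R) (k : int) : R := if k == 0 then 1 else g / `|k%:~R| `^ a.

Lemma decay1_ge0 a g k : 0 <= g -> 0 <= decay1 a g k.
Proof. by move=> g0; rewrite /decay1; case: ifP => // _; rewrite divr_ge0// powR_ge0. Qed.

Lemma esum_int_neq0 (F : int -> \bar R) : (forall k, 0 <= F k)%E ->
  \esum_(k in [set k | k != 0]) F k =
  (\sum_(n <oo) F n.+1%:Z + \sum_(n <oo) F (- n.+1%:Z)%R)%E.
Proof.
move=> F0; rewrite (esumID [set k | 0 < k])//; congr (_ + _)%E.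
- rewrite nneseries_esumT//; apply: (reindex_esum _ _ (fun n : nat => n.+1%:Z)).
  split=> //=; first by move=> n m _ _ [].
  by move=> [[|n]|n] [/= _ k0]//; exists n.
- rewrite nneseries_esumT//; apply: (reindex_esum _ _ (fun n : nat => - n.+1%:Z)).
  split=> //=; first by move=> n m _ _ /oppr_inj [].
  by move=> [[|n]|n] [/= k1 k0]//; exists n.
Qed.

Lemma esum_decay1_neq0 a g : 1 < a -> 0 <= g ->
  \esum_(k in [set k | k != 0]) (decay1 a g k)%:E = (2 * g * zeta a)%:E.
Proof.
move=> a1 g0; rewrite esum_int_neq0; last by move=> k; rewrite lee_fin decay1_ge0.
have e (n : nat) : (decay1 a g n.+1%:Z = g * n.+1%:R `^ (- a))%R.
  by rewrite /decay1 /= powRN pmulrn ger0_norm.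
rewrite (eq_eseriesr (g := fun n => g%:E * (n.+1%:R `^ (- a))%:E)%E); last first.
  by move=> n _; rewrite e EFinM.
rewrite nneseriesZl; last by move=> n _; rewrite lee_fin powR_ge0.
rewrite nneseries_zeta//.
rewrite (eq_eseriesr (g := fun n => g%:E * (n.+1%:R `^ (- a))%:E)%E); last first.
  by move=> n _; rewrite -EFinM -e /decay1 oppr_eq0 mulrNz normrN.
rewrite nneseriesZl; last by move=> n _; rewrite lee_fin powR_ge0.
by rewrite nneseries_zeta// -!EFinM -EFinD; congr (_%:E); ring.
Qed.

Lemma esum_decay1 a g : 1 < a -> 0 <= g ->
  \esum_(k in [set: int]) (decay1 a g k)%:E = (1 + 2 * g * zeta a)%:E.
Proof.
move=> a1 g0; rewrite (esumID [set 0]); last by move=> k _; rewrite lee_fin decay1_ge0.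
rewrite setTI esum_set1 ?lee_fin ?decay1_ge0// {1}/decay1 eqxx EFinD; congr (_ + _)%E.
rewrite -esum_decay1_neq0//; congr esum; rewrite setTI; apply/seteqP; split=> k/=.
  by move=> /eqP.
by move/eqP.
Qed.

End zeta_bounds.

(** * Sums over frequency vectors *)

Section tuple_sums.
Variable R : realType.
Implicit Types (a : R) (g : nat -> R).

(** Frequency vectors grow at the end, as the component-by-component algorithm and the indexing of
    the weights demand; integration over the cube peels off the first coordinate instead. *)
Definition rtuple (I : Type) n (h : n.-tuple I) (k : I) : n.+1.-tuple I :=
  [tuple of rcons h k].

Lemma tnth_rtuple_widen (I : Type) n (h : n.-tuple I) k (j : 'I_n) :
  tnth (rtuple h k) (widen_ord (leqnSn n) j) = tnth h j.
Proof. by rewrite (tnth_nth (tnth h j)) /= nth_rcons size_tuple ltn_ord -tnth_nth. Qed.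

Lemma tnth_rtuple_max (I : Type) n (h : n.-tuple I) k :
  tnth (rtuple h k) ord_max = k.
Proof. by rewrite (tnth_nth k) /= nth_rcons size_tuple ltnn eqxx. Qed.

Lemma rtuple_bij (I : Type) n :
  set_bij [set: n.-tuple I * I] [set: n.+1.-tuple I] (fun p => rtuple p.1 p.2).
Proof.
split=> //.
- move=> [h k] [h' k'] _ _ /= e; congr pair.
    by apply: eq_from_tnth => j; rewrite -(tnth_rtuple_widen h k) e tnth_rtuple_widen.
  by rewrite -(tnth_rtuple_max h k) e tnth_rtuple_max.
- move=> h _; exists ([tuple tnth h (widen_ord (leqnSn n) j) | j < n], tnth h ord_max) => //=.
  apply: eq_from_tnth => j; case: (unliftP ord_max j) => [i ->|->].
    have -> : lift ord_max i = widen_ord (leqnSn n) i.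
      by apply: val_inj; rewrite /= /bump leqNgt ltn_ord.
    by rewrite tnth_rtuple_widen tnth_mktuple.
  by rewrite tnth_rtuple_max.
Qed.

Lemma esum_rtuple (I : choiceType) n (F : n.+1.-tuple I -> \bar R) :
  (forall h, 0 <= F h)%E ->
  \esum_(h in setT) F h = \esum_(h in setT) \esum_(k in setT) F (rtuple h k).
Proof.
move=> F0; rewrite (reindex_esum _ _ _ F (rtuple_bij I n)).
rewrite esum_esum//; congr esum; apply/seteqP; split => //.
Qed.

Lemma prod_rtuple n (f : 'I_n.+1 -> int -> R) (h : n.-tuple int) k :
  \prod_(j < n.+1) f j (tnth (rtuple h k) j) =
  \prod_(j < n) f (widen_ord (leqnSn n) j) (tnth h j) * f ord_max k.
Proof.
rewrite big_ord_recr /= tnth_rtuple_max; congr (_ * _).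
by apply: eq_bigr => j _; rewrite tnth_rtuple_widen.
Qed.

Definition decays a g s (h : s.-tuple int) : R :=
  \prod_(j < s) decay1 a (g j) (tnth h j).

Lemma decays_ge0 a g s (h : s.-tuple int) : (forall j, 0 <= g j) -> 0 <= decays a g h.
Proof. by move=> g0; apply: prodr_ge0 => j _; exact: decay1_ge0. Qed.

Lemma decays_zero a g s : decays a g (zero_freq s) = 1 :> R.
Proof. by rewrite /decays big1// => j _; rewrite tnth_mktuple /decay1 eqxx. Qed.

Lemma decays_rtuple a g s (h : s.-tuple int) k :
  decays a g (rtuple h k) = decays a g h * decay1 a (g s) k.
Proof. by rewrite /decays (prod_rtuple (fun j => decay1 a (g j))). Qed.

Lemma decayE alpha g s (h : s.-tuple int) : decay alpha g h = decays (2 * alpha) g h.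
Proof.
rewrite /decay /decays big_mkcond; apply: eq_bigr => j _; rewrite /decay1.
by case: eqP.
Qed.

Lemma esumZl (I : choiceType) (A : set I) (c : R) (F : I -> \bar R) : 0 <= c ->
  (forall i, 0 <= F i)%E ->
  \esum_(i in A) (c%:E * F i)%E = (c%:E * \esum_(i in A) F i)%E.
Proof.
move=> c0 F0.
have ub (d : R) (G : I -> \bar R) : 0 <= d -> (forall i, 0 <= G i)%E ->
    (\esum_(i in A) (d%:E * G i) <= d%:E * \esum_(i in A) G i)%E.
  move=> d0 G0; apply: ge_ereal_sup => _ [X [finX XA] <-].
  rewrite -ge0_mule_fsumr//.
  apply: lee_wpmul2l; first by rewrite lee_fin.
  by apply: ereal_sup_ubound; exists X.
apply/eqP; rewrite eq_le ub//=.
have [->|c1] := eqVneq c 0.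
  by rewrite mul0e; apply: esum_ge0 => i Ai; rewrite mul0e.
have cp : 0 < c by rewrite lt_neqAle eq_sym c1.
rewrite -lee_pdivlMl//.
(* The reverse inequality is [ub] for the constant [c^-1] and the family [c * F]. *)
apply: le_trans (ub c^-1 _ _ _); last 2 first.
- by rewrite invr_ge0.
- by move=> i; rewrite mule_ge0// ?lee_fin// F0.
by apply: le_esum => i Ai; rewrite muleA -EFinM mulVf// mul1e.
Qed.

Lemma esum_decays a g s : 1 < a -> (forall j, 0 <= g j) ->
  \esum_(h in [set: s.-tuple int]) (decays a g h)%:E =
  (\prod_(j < s) (1 + 2 * g j * zeta a))%:E.
Proof.
move=> a1 g0; elim: s => [|s IHs].
  rewrite big_ord0 (_ : [set: _] = [set [tuple]]).
    by rewrite esum_set1 /decays ?big_ord0// lee_fin.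
  by apply/seteqP; split=> // h _; exact: (tuple0 h).
rewrite esum_rtuple; last by move=> h; rewrite lee_fin decays_ge0.
rewrite big_ord_recr /= mulrC EFinM -IHs -esumZl; last 2 first.
- by rewrite addr_ge0// mulr_ge0 ?zeta_ge0// mulr_ge0.
- by move=> h; rewrite lee_fin decays_ge0.
apply: eq_esum => h _; rewrite -esum_decay1// muleC -esumZl ?decays_ge0//.
- by apply: eq_esum => k _; rewrite decays_rtuple EFinM.
- by move=> k; rewrite lee_fin decay1_ge0.
Qed.

(** For [t] in [[0, x + y]] the ratio [t / (x + y)] is at most its own [l]-th power; the cases
    [t = x] and [t = y] add up to the claim. *)
Lemma powR_subadd (l x y : R) : 0 < l <= 1 -> 0 <= x -> 0 <= y ->
  (x + y) `^ l <= x `^ l + y `^ l.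
Proof.
move=> /andP[l0 l1] x0 y0.
have [->|xy] := eqVneq (x + y) 0; first by rewrite powR0 ?gt_eqF// addr_ge0 ?powR_ge0.
have s0 : 0 < x + y by rewrite lt_neqAle eq_sym xy addr_ge0.
have H (t : R) : 0 <= t -> t <= x + y -> t / (x + y) * (x + y) `^ l <= t `^ l.
  move=> t0 tle; rewrite -{2}(divfK xy t) powRM ?divr_ge0 ?(ltW s0)//.
  rewrite ler_wpM2r ?powR_ge0//.
  have [->|tn] := eqVneq t 0; first by rewrite mul0r powR_ge0.
  apply: ger1_powR => //.
  by rewrite ler_pdivrMr// mul1r tle andbT divr_gt0// lt_neqAle eq_sym tn.
apply: le_trans (lerD (H x x0 _) (H y y0 _)); rewrite ?lerDl ?lerDr//.
by rewrite -mulrDl -mulrDl divff// mul1r.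
Qed.

(** Jensen's inequality: the [l]-th power of a sum is at most the sum of the [l]-th powers. It is
    proved on finite partial sums and passes to their supremum. *)
Lemma esum_powR_le (I : choiceType) (A : set I) (F : I -> R) (l S : R) :
  0 < l <= 1 -> (forall i, 0 <= F i) -> 0 <= S ->
  (\esum_(i in A) (F i `^ l)%:E <= S%:E)%E ->
  (\esum_(i in A) (F i)%:E <= (S `^ (1 / l))%:E)%E.
Proof.
move=> l01 F0 S0 H; have /andP[l0 l1] := l01.
apply: ge_ereal_sup => _ [X [finX XA] <-].
rewrite fsbig_finite//= sumEFin lee_fin.
have X0 : 0 <= \sum_(i <- fset_set X) F i by apply: sumr_ge0.
rewrite -[leLHS]powRr1// -{1}(divff (lt0r_neq0 l0)) powRrM div1r.
apply: ge0_ler_powR; rewrite ?nnegrE ?powR_ge0 ?invr_ge0 ?(ltW l0)//.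
rewrite -lee_fin; apply: le_trans H; apply: (@le_trans _ _ (\sum_(i <- fset_set X) (F i `^ l))%:E).
  rewrite lee_fin; elim: (enum_fset _) => [|i r IHr]; first by rewrite !big_nil powR0 ?lt0r_neq0.
  by rewrite !big_cons (le_trans (powR_subadd _ _ _))// ?sumr_ge0// lerD2l.
by apply: ereal_sup_ubound; exists X => //; rewrite fsbig_finite//= sumEFin.
Qed.

Lemma decay1_powR a (x l : R) k : 0 <= x -> decay1 a x k `^ l = decay1 (a * l) (x `^ l) k.
Proof.
move=> x0; rewrite /decay1; case: eqP => _; first by rewrite powR1.
rewrite powRM ?invr_ge0 ?powR_ge0//; congr (_ * _).
by rewrite -powRN -powRrM mulNr powRN.
Qed.

(** Powers of [decays] stay in the same family, so every bound on [decays] can be quoted for the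
    exponent [a * l] and the weights [g j ^ l]. *)
Lemma decays_powR a g s (h : s.-tuple int) (l : R) : (forall j, 0 <= g j) ->
  decays a g h `^ l = decays (a * l) (fun j => g j `^ l) h.
Proof.
move=> g0.
suff [] : 0 <= decays a g h /\ decays a g h `^ l = decays (a * l) (fun j => g j `^ l) h by [].
rewrite /decays; elim/big_rec2: _ => [|j x y _ [y0 IH]]; first by rewrite powR1.
by rewrite mulr_ge0 ?decay1_ge0// powRM ?decay1_ge0// decay1_powR// IH.
Qed.

End tuple_sums.

(** * Sums over the dual lattice *)

Section cbc.
Variable R : realType.
Variable N : nat.
Hypothesis N0 : (0 < N)%N.
Implicit Types (a : R) (g : nat -> R) (z : nat -> nat).

(** [z] is a function on all of [nat], so that one generating vector serves all its prefixes. *)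
Definition int_dot n z (h : n.-tuple int) : int := \sum_(j < n) tnth h j * (z j)%:Z.

Lemma int_dot_rtuple n z (h : n.-tuple int) k :
  int_dot z (rtuple h k) = int_dot z h + k * (z n)%:Z.
Proof.
rewrite /int_dot big_ord_recr /= tnth_rtuple_max; congr (_ + _).
by apply: eq_bigr => j _; rewrite tnth_rtuple_widen.
Qed.

Lemma int_dot_zero n z : int_dot z (zero_freq n) = 0.
Proof. by rewrite /int_dot big1// => j _; rewrite tnth_mktuple mul0r. Qed.

Lemma mem_set_bool (T : Type) (p : pred T) x : (x \in [set y | p y]) = p x.
Proof. by apply/idP/idP => [/set_mem|/mem_set]. Qed.

Definition lin_sol (b k : int) : pred 'I_N := fun w => (N %| b + k * w%:Z)%Z.

(* A unit [w] solving [b + k * w = 0 (mod N)] forces [gcd(N, k) = gcd(N, b)]: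
   only multiples [k] of [G = gcd(N, b)] occur, each for at most [G] units,
   and this multiplicity is absorbed by the decay since [G * G ^ (- a) <= 1]. *)
Lemma card_lin_congruence (b k : int) (w0 : nat) : (w0 < N)%N -> coprime N w0 ->
    (N %| b + k * w0%:Z)%Z ->
  gcdn N `|k| = gcdn N `|b| /\
  (#|lin_sol b k| <= gcdn N `|b|)%N.
Proof.
move=> w0N cw H.
have HG : gcdn N `|k| = gcdn N `|b|.
  have dvd (c c' : int) : (N %| c + c')%Z -> (gcdn N `|c| %| gcdn N `|c'|)%N.
    move=> H'; rewrite dvdn_gcd dvdn_gcdl /=.
    have -> : c' = (c + c') - c by ring.
    change ((gcdn N `|c|)%:Z %| (c + c') - c)%Z.
    by apply: rpredB; [apply: dvdz_trans H'|]; rewrite dvdzE /= ?dvdn_gcdl ?dvdn_gcdr.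
  have e2 : gcdn N `|b| = gcdn N `|k * w0%:Z|.
    by apply/eqP; rewrite eqn_dvd !dvd// addrC.
  by rewrite e2 abszM /= Gauss_gcdl.
split=> //; rewrite -HG; set G := gcdn N `|k|.
have G0 : (0 < G)%N by rewrite gcdn_gt0 N0.
have GN : (G %| N)%N by rewrite dvdn_gcdl.
set M := (N %/ G)%N.
have M0 : (0 < M)%N by rewrite divn_gt0// dvdn_leq.
have NE : N = (G * M)%N by rewrite mulnC divnK.
rewrite -[leqRHS]card_ord.
have ltG (w : 'I_N) : (w %/ M < G)%N by rewrite ltn_divLR// -NE.
(* Two solutions are congruent modulo [M = N / G], so a solution is determined by its quotient by
   [M], which takes at most [G] values. *)
apply: (leq_card_in (fun w : 'I_N => Ordinal (ltG w))).
move=> w w' Hw Hw' /(congr1 val) /= eq.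
apply: val_inj => /=; rewrite (divn_eq w M) (divn_eq w' M) eq; congr (_ + _)%N.
have : (N %| k * (w%:Z - w'%:Z))%Z.
  have -> : k * (w%:Z - w'%:Z) = (b + k * w%:Z) - (b + k * w'%:Z) by ring.
  exact: rpredB.
rewrite dvdzE abszM /= [X in (X %| _)%N -> _]NE.
have [k' kE] : exists k', `|k|%N = (G * k')%N.
  by exists (`|k| %/ G)%N; rewrite mulnC divnK// dvdn_gcdr.
rewrite kE -mulnA dvdn_pmul2l// Gauss_dvdr; last first.
  have : gcdn (G * M) (G * k') = G by rewrite -NE -kE.
  by rewrite -muln_gcdr => /eqP; rewrite -{2}[G]muln1 eqn_pmul2l.
move=> Md; have : (M %| (w%:Z - w'%:Z))%Z by [].
by rewrite -eqz_mod_dvd !modz_nat => /eqP [].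
Qed.

Lemma decay1_scale a (x : R) (G : nat) (m : int) : (0 < G)%N -> m != 0 ->
  decay1 a x (G%:Z * m) = G%:R `^ (- a) * decay1 a x m.
Proof.
move=> G0 m0; rewrite /decay1 mulf_eq0 (negbTE m0) orbF eqz_nat gtn_eqF//.
by rewrite intrM normrM powRM// invfM powRN pmulrn normr_nat mulrCA.
Qed.

Definition nz_int : set int := [set k | k != 0].

Definition nz_sols (b : int) (w : nat) : set int :=
  nz_int `&` [set k | (N %| b + k * w%:Z)%Z].

(** After exchanging the sums, [k] counts at most [G] times, and only if [G] divides [k]; the
    substitution [k = G * m] then leaves the full one-dimensional sum with a factor
    [G ^ (1 - a) <= 1]. The bound is uniform in [b], hence usable under a sum over the other
    coordinates. *)
Lemma sum_coprime_decay1 a (x : R) (b : int) : 1 < a -> 0 <= x ->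
  (\sum_(w < N | coprime N w)
     \esum_(k in nz_sols b w) (decay1 a x k)%:E
   <= (2 * x * zeta a)%:E)%E.
Proof.
move=> a1 x0; set G := gcdn N `|b|.
have G0 : (0 < G)%N by rewrite gcdn_gt0 N0.
rewrite (eq_bigr (fun w : 'I_N => \esum_(k in nz_int)
    (if lin_sol b k w then (decay1 a x k)%:E else 0%E))); last first.
  move=> w _; rewrite esum_mkcondr; apply: eq_esum => k _.
  by rewrite mem_set_bool.
rewrite -esum_sum; last by move=> k w _ _; case: ifP => // _; rewrite lee_fin decay1_ge0.
apply: (@le_trans _ _ (\esum_(k in nz_int)
   (if (G %| `|k|)%N then (G%:R * decay1 a x k)%:E else 0%E))).
  apply: le_esum => k /= k0; rewrite -big_mkcondr /=.
  have [[w0 /andP[c0 h0]]|H] := pselect (exists w : 'I_N, coprime N w && lin_sol b k w); last first.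
    rewrite big_pred0; first by case: ifP => // _; rewrite lee_fin mulr_ge0 ?decay1_ge0.
    by move=> w; apply/negP => Hw; apply: H; exists w.
  have [gk cardG] := card_lin_congruence (ltn_ord w0) c0 h0.
  rewrite {1}/G -gk dvdn_gcdr.
  rewrite sumEFin lee_fin sumr_const -[leLHS]mulr_natl ler_wpM2r ?decay1_ge0// ler_nat.
  by apply: leq_trans cardG; apply/subset_leq_card/fintype.subsetP => w /andP[].
rewrite -esum_decay1_neq0//.
rewrite (esumID [set k : int | (G %| `|k|)%N]); last first.
  by move=> k _; case: ifP => // _; rewrite lee_fin mulr_ge0 ?decay1_ge0.
rewrite [X in (_ + X)%E]esum1 ?adde0; last by move=> k [_ /= /negP/negbTE ->].
rewrite (reindex_esum [set k : int | k != 0] _ (fun m => G%:Z * m)); last first.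
  rewrite /nz_int; split=> [m /= m0|m m' _ _ /mulfI|k [/= k0 /(@dvdzP G)[m e]]].
  - by rewrite mulf_neq0//= ?eqz_nat -?lt0n ?abszM ?dvdn_mulr.
  - by apply; rewrite eqz_nat -lt0n.
  - by exists m; rewrite ?e 1?mulrC//=; apply: contraNneq k0 => m0; rewrite e m0 mul0r.
apply: le_esum => m /= m0; rewrite abszM dvdn_mulr//= lee_fin decay1_scale// mulrA.
rewrite ler_piMl ?decay1_ge0//.
rewrite -[X in X * _]powRr1// -powRD ?pnatr_eq0 ?gtn_eqF ?implybT//.
rewrite -[leRHS](powRr0 G%:R) ler_powR ?ler1n//.
by rewrite subr_le0 ltW.
Qed.

Definition dual n z : set (n.-tuple int) := [set h | (N %| int_dot z h)%Z].
Arguments dual n z : clear implicits.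

(** For [a = 2 * alpha] this is 1 plus the squared worst-case error of the lattice rule
    ([wce_lattice]); the 1 belongs to the zero frequency, kept here so that the recursion on the
    dimension is clean. *)
Definition dual_sum a g n z : \bar R := \esum_(h in dual n z) (decays a g h)%:E.

(* The part of [dual_sum a g n.+1] carried by the frequencies with non-zero last
   entry, when [w] is the last component of the generating vector: this is what
   a step of the component-by-component algorithm minimizes. *)
Definition dual_incr a g n z (w : nat) : \bar R :=
  \esum_(h in [set: n.-tuple int])
    \esum_(k in nz_sols (int_dot z h) w) (decays a g h * decay1 a (g n) k)%:E.

Lemma eq_int_dot n z z' (h : n.-tuple int) : (forall j, (j < n)%N -> z j = z' j) ->
  int_dot z h = int_dot z' h.
Proof. by move=> zz; apply: eq_bigr => j _; rewrite zz. Qed.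

Lemma eq_dual_sum a g n z z' : (forall j, (j < n)%N -> z j = z' j) ->
  dual_sum a g n z = dual_sum a g n z'.
Proof.
move=> zz; congr esum; apply/seteqP.
by split=> h; rewrite /dual /= (eq_int_dot _ zz).
Qed.

Lemma eq_dual_incr a g n z z' w : (forall j, (j < n)%N -> z j = z' j) ->
  dual_incr a g n z w = dual_incr a g n z' w.
Proof. by move=> zz; apply: eq_esum => h _; rewrite (eq_int_dot _ zz). Qed.

Section nonneg.
Variables (a : R) (g : nat -> R).
Hypotheses (a1 : 1 < a) (g0 : forall j, 0 <= g j).

Lemma dual_sumS n z : dual_sum a g n.+1 z = (dual_sum a g n z + dual_incr a g n z (z n))%E.
Proof.
rewrite /dual_sum esum_mkcond esum_rtuple; last first.
  by move=> h; case: ifP; rewrite // lee_fin decays_ge0.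
rewrite [X in (X + _)%E]esum_mkcond -esumD; last 2 first.
- by move=> h; case: ifP; rewrite // lee_fin decays_ge0.
- by move=> h _; apply: esum_ge0 => k _; rewrite lee_fin mulr_ge0 ?decays_ge0 ?decay1_ge0.
apply: eq_esum => h _; rewrite (esumID [set 0]); last first.
  by move=> k _; case: ifP; rewrite // lee_fin decays_ge0.
have H k : (rtuple h k \in dual n.+1 z) = (N %| int_dot z h + k * (z n)%:Z)%Z.
  by rewrite /dual mem_set_bool int_dot_rtuple.
rewrite setTI esum_set1; last by case: ifP; rewrite // lee_fin decays_ge0.
congr (_ + _)%E.
  rewrite H mul0r addr0 /dual mem_set_bool; case: ifP => // _.
  by rewrite decays_rtuple /decay1 eqxx mulr1.
rewrite setTI; have -> : ~` [set 0] = nz_int by apply/seteqP; split=> k /= /eqP.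
by rewrite /nz_sols esum_mkcondr; apply: eq_esum => k _; rewrite H mem_set_bool decays_rtuple.
Qed.

Lemma dual_sum_ge0 n z : (0 <= dual_sum a g n z)%E.
Proof. by apply: esum_ge0 => h _; rewrite lee_fin decays_ge0. Qed.

Lemma dual_sum_split n z : dual_sum a g n z =
  (1 + \esum_(h in dual n z `&` ~` [set zero_freq n]) (decays a g h)%:E)%E.
Proof.
rewrite /dual_sum (esumID [set zero_freq n]); last by move=> h _; rewrite lee_fin decays_ge0.
congr (_ + _)%E; rewrite (_ : _ `&` _ = [set zero_freq n]).
  by rewrite esum_set1 ?lee_fin ?decays_ge0// decays_zero.
apply/seteqP; split=> [h []//|h /= ->]; split=> //.
by rewrite /dual /= int_dot_zero dvdz0.
Qed.

Lemma dual_sum_ge1 n z : (1 <= dual_sum a g n z)%E.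
Proof.
by rewrite dual_sum_split leeDl// esum_ge0// => h _; rewrite lee_fin decays_ge0.
Qed.

Lemma dual_incr_ge0 n z w : (0 <= dual_incr a g n z w)%E.
Proof.
by do 2! apply: esum_ge0 => ? _; rewrite lee_fin mulr_ge0 ?decays_ge0 ?decay1_ge0.
Qed.

Lemma dual_sum_fin n z : dual_sum a g n z \is a fin_num.
Proof.
rewrite ge0_fin_numE ?dual_sum_ge0//.
apply: (@le_lt_trans _ _ (\esum_(h in [set: n.-tuple int]) (decays a g h)%:E)).
  rewrite [leLHS]esum_mkcond; apply: le_esum => h _.
  by case: ifP; rewrite // lee_fin decays_ge0.
by rewrite esum_decays// ltry.
Qed.

Lemma sum_coprime_dual_incr n z :
  (\sum_(w < N | coprime N w) dual_incr a g n z w <=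
   (2 * g n * zeta a * \prod_(j < n) (1 + 2 * g j * zeta a))%:E)%E.
Proof.
rewrite -esum_sum; last first.
  by move=> h w _ _; apply: esum_ge0 => k _; rewrite lee_fin mulr_ge0 ?decays_ge0 ?decay1_ge0.
have c0 : 0 <= 2 * g n * zeta a by rewrite mulr_ge0 ?zeta_ge0// mulr_ge0.
rewrite EFinM -esum_decays// -esumZl//; last by move=> h; rewrite lee_fin decays_ge0.
apply: le_esum => h _.
rewrite (eq_bigr (fun w : 'I_N => (decays a g h)%:E *
    \esum_(k in nz_sols (int_dot z h) w) (decay1 a (g n) k)%:E)%E); last first.
  move=> w _; rewrite -esumZl ?decays_ge0//; last by move=> k; rewrite lee_fin decay1_ge0.
rewrite -ge0_sume_distrr; last first.
  by move=> w _; apply: esum_ge0 => k _; rewrite lee_fin decay1_ge0.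
by rewrite muleC lee_wpmul2r ?lee_fin ?decays_ge0// sum_coprime_decay1.
Qed.

Lemma dual_incr_le_mean n z : exists2 w, ((w < N)%N && coprime N w) &
  (dual_incr a g n z w <=
   ((totient N)%:R^-1 * (2 * g n * zeta a * \prod_(j < n) (1 + 2 * g j * zeta a)))%:E)%E.
Proof.
set S := (2 * _ * _ * _).
(* A unit from which to start the minimum: [0] if [N = 1], and [1] otherwise. *)
have [w0 cw0] : exists w : 'I_N, coprime N w.
  have [N1|N1] := eqVneq N 1%N.
    by exists (Ordinal N0); rewrite {1}N1 coprime1n.
  have H1 : (1 < N)%N by rewrite ltn_neqAle eq_sym N1.
  by exists (Ordinal H1); rewrite coprimen1.
have [w cw wmin] := @arg_minP _ _ _ w0 (fun w : 'I_N => coprime N w) (fun w => dual_incr a g n z w) cw0.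
exists w; first by rewrite ltn_ord.
have phi0 : (0 < totient N)%N by rewrite totient_gt0.
have H := sum_coprime_dual_incr n z.
have : (\sum_(w' < N | coprime N w') dual_incr a g n z w <= S%:E)%E.
  by apply: le_trans H; apply: lee_sum => w' cw'; exact: wmin.
have card_tot : #|[pred w : 'I_N | coprime N w]| = totient N.
  by rewrite totient_count_coprime big_mkord -big_mkcond sum1_card.
case: (dual_incr a g n z w) (dual_incr_ge0 n z w) => [x||]// _.
  rewrite sumEFin !lee_fin sumr_const -[leLHS]mulr_natl card_tot => H'.
  by rewrite -ler_pdivrMl ?invr_gt0 ?ltr0n// invrK.
(* An infinite minimum would make the whole sum infinite, against its bound [S]. *)
rewrite (bigD1 w0)//= addye// gt_eqF// (@lt_le_trans _ _ 0%E)//.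
by apply: sume_ge0.
Qed.

End nonneg.

(** Superadditivity of the power [1 / l], read off from [powR_subadd]; it combines the bounds of
    successive steps of the algorithm. *)
Lemma powR_superadd (l x y A B : R) : 0 < l <= 1 -> 0 <= x -> 0 <= y -> 0 <= A -> 0 <= B ->
  x <= A `^ (1 / l) -> y <= B `^ (1 / l) -> x + y <= (A + B) `^ (1 / l).
Proof.
move=> l01 x0 y0 A0 B0 xA yB; have /andP[l0 l1] := l01.
have K (t : R) : 0 <= t -> (t `^ (1 / l)) `^ l = t.
  by move=> t0; rewrite -powRrM div1r mulVf ?gt_eqF// powRr1.
have K' (t : R) : 0 <= t -> (t `^ l) `^ (1 / l) = t.
  by move=> t0; rewrite -powRrM div1r mulfV ?gt_eqF// powRr1.
rewrite -(K' (x + y)) ?addr_ge0//.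
apply: ge0_ler_powR; rewrite ?nnegrE ?powR_ge0 ?addr_ge0 ?divr_ge0 ?(ltW l0)//.
apply: le_trans (powR_subadd l01 x0 y0) _; rewrite -(K A)// -(K B)//.
by apply: lerD; apply: ge0_ler_powR; rewrite ?nnegrE ?powR_ge0 ?(ltW l0).
Qed.

Section cbc_bound.
Variables (a : R) (g : nat -> R) (l : R).
Hypotheses (a1 : 1 < a) (g0 : forall j, 0 <= g j) (l01 : 0 < l <= 1) (al1 : 1 < a * l).

Let gl j := g j `^ l.
Let cbc_prod n := \prod_(j < n) (1 + 2 * gl j * zeta (a * l)).

(** The averaging argument is applied to the weights [gl] and the exponent [a * l], and yields a
    unit [w]. The minimality of [w0], which concerns the original weights, is used against this [w],
    and [esum_powR_le] leads back from the [l]-th powers. *)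
Lemma dual_incr_le n z w0 :
  (forall w, (w < N)%N -> coprime N w -> dual_incr a g n z w0 <= dual_incr a g n z w)%E ->
  (dual_incr a g n z w0 <=
    (((totient N)%:R^-1 * (2 * gl n * zeta (a * l) * cbc_prod n)) `^ (1 / l))%:E)%E.
Proof.
move=> H; have gl0 j : 0 <= gl j by exact: powR_ge0.
have [w /andP[wN cw] Hw] := dual_incr_le_mean al1 gl0 n z.
apply: le_trans (H w wN cw) _.
(* Jensen's inequality asks for a single unordered sum, here over the pairs [(h, k)]. *)
rewrite /dual_incr esum_esum in Hw; last first.
  by move=> *; rewrite lee_fin mulr_ge0 ?decays_ge0 ?decay1_ge0.
rewrite /dual_incr esum_esum; last by move=> *; rewrite lee_fin mulr_ge0 ?decays_ge0 ?decay1_ge0.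
apply: esum_powR_le => //.
- by move=> p; rewrite mulr_ge0 ?decays_ge0 ?decay1_ge0.
- rewrite mulr_ge0 ?invr_ge0// mulr_ge0//; first by rewrite mulr_ge0 ?zeta_ge0// mulr_ge0.
  by apply: prodr_ge0 => j _; rewrite addr_ge0// mulr_ge0 ?zeta_ge0// mulr_ge0.
- apply: le_trans Hw; apply: le_esum => -[h k] _ /=.
  by rewrite lee_fin powRM ?decays_ge0 ?decay1_ge0// decays_powR// decay1_powR.
Qed.

(** With [c n] for [2 * gl n * zeta (a * l)], the increment at step [n] contributes
    [c n * cbc_prod n], and [(cbc_prod n - 1) + c n * cbc_prod n] is [cbc_prod n.+1 - 1];
    [powR_superadd] adds the bounds under the root. The isolated 1 stems from the zero frequency. *)
Lemma cbc_dual_sum_le n z :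
  (forall j w, (j < n)%N -> (w < N)%N -> coprime N w ->
     dual_incr a g j z (z j) <= dual_incr a g j z w)%E ->
  (dual_sum a g n z <=
    (1 + ((totient N)%:R^-1 * (-1 + cbc_prod n)) `^ (1 / l))%:E)%E.
Proof.
have l0 : 0 < l by case/andP: l01.
have gl0 j : 0 <= gl j by exact: powR_ge0.
have c0 j : 0 <= 2 * gl j * zeta (a * l) by rewrite mulr_ge0 ?zeta_ge0// mulr_ge0.
have p1 j : 1 <= cbc_prod j.
  by rewrite /cbc_prod; elim/big_rec: _ => // i x _ x1; rewrite mulr_ege1// lerDl.
elim: n => [|n IHn] H.
  rewrite /dual_sum (_ : dual 0 z = [set [tuple]]).
    by rewrite esum_set1 /decays /cbc_prod ?big_ord0 ?lee_fin// addNr mulr0 powR0 ?addr0// gt_eqF// divr_gt0.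
  apply/seteqP; split=> h _; first exact: (tuple0 h).
  by rewrite /dual /= /int_dot big_ord0 dvdz0.
have {}IHn := IHn (fun j w jn => H j w (leqW jn)).
have Hn := dual_incr_le (fun w => H n w (ltnSn n)).
rewrite dual_sumS//.
have := dual_sum_fin a1 g0 n z; have := dual_sum_ge1 a g0 n z.
case: (dual_sum _ _ _ _) IHn => // D; rewrite !lee_fin => IHn D1 _.
case: (dual_incr _ _ _ _ _) (dual_incr_ge0 a g0 n z (z n)) Hn => // t; rewrite !lee_fin => t0 Hn.
rewrite -lerBlDl addrAC.
have := powR_superadd l01 _ t0 _ _ _ Hn.
move/(_ (D - 1) ((totient N)%:R^-1 * (-1 + cbc_prod n))).
rewrite subr_ge0 lerBlDl => /(_ D1 _ _ IHn) HH; apply: (le_trans (HH _ _)).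
- by rewrite mulr_ge0 ?invr_ge0// addrC subr_ge0.
- by rewrite mulr_ge0 ?invr_ge0// mulr_ge0// (le_trans ler01).
rewrite -mulrDr /cbc_prod big_ord_recr /= le_eqVlt; apply/orP; left; apply/eqP.
by congr ((_ * _) `^ _); ring.
Qed.

End cbc_bound.
End cbc.

(** * Upper bound for the worst-case error *)

Section worst_case_upper.
Variable R : realType.
Implicit Types (alpha : R) (gamma : nat -> R).

Lemma sqr_normc (z : R[i]) : Normc.normc z ^+ 2 = complex.Re z ^+ 2 + complex.Im z ^+ 2.
Proof. by case: z => x y; rewrite /= sqr_sqrtr// addr_ge0 ?sqr_ge0. Qed.

Lemma Re_mul_cis2pi (c : R[i]) t : complex.Re (c * cis2pi t) =
  complex.Re c * cos (2 * pi * t) - complex.Im c * sin (2 * pi * t).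
Proof. by case: c. Qed.

Lemma Re_sum (I : Type) (r : seq I) (F : I -> R[i]) :
  complex.Re (\sum_(i <- r) F i) = \sum_(i <- r) complex.Re (F i).
Proof. by elim: r => [|i r IHr]; rewrite ?big_nil// !big_cons -IHr; case: (F i);
  case: (\sum_(_ <- r) _). Qed.

Lemma dot_zero_freq s (x : s.-tuple R) : dot (zero_freq s) x = 0.
Proof. by rewrite /dot big1// => j _; rewrite tnth_mktuple mul0r. Qed.

Lemma fourier_coef_zero s (f : s.-tuple R -> R) :
  complex.Re (fourier_coef f (zero_freq s)) = cube_integral f.
Proof.
rewrite /fourier_coef /=; congr cube_integral; apply/funext => x.
by rewrite dot_zero_freq oppr0 mulr0 cos0 mulr1 mul0r subr0.
Qed.

Lemma has_sumP (K : numFieldType) (I : choiceType) (u : I -> K) (l : K) :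
  has_sum u l <-> forall e : K, 0 < e -> \forall A \near summability.totally,
    `|l - \sum_(i <- enum_fset A) u i| < e.
Proof.
have FF := @summability.totally_filter I.
rewrite /has_sum; split.
  move=> /cvgrPdist_lt + e e0 => /(_ e e0); apply: filterS => A.
  by rewrite (big_seq_fsetE _ A xpredT u).
move=> H; apply/cvgrPdist_lt => e e0; have := H e e0; apply: filterS => A.
by rewrite (big_seq_fsetE _ A xpredT u).
Qed.

Lemma has_sum_near_fset (I : choiceType) (u : I -> R[i]) (l : R[i]) (e : R) : 0 < e ->
  has_sum u l ->
  \forall A \near summability.totally,
    `|complex.Re l - \sum_(i <- enum_fset A) complex.Re (u i)| < e.
Proof.
move=> e0; have FF := @summability.totally_filter I.
move=> /(has_sumP u l).1 /(_ e%:C); rewrite ltcR => /(_ e0); apply: filterS => A H.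
have := le_lt_trans (normc_ge_Re _) H; rewrite ltcR; apply: le_lt_trans.
by rewrite -Re_sum; case: l {H} => ? ?; case: (\sum_(_ <- _) _).
Qed.

Definition mean_cos N s (P : 'I_N -> s.-tuple R) (h : s.-tuple int) : R :=
  N%:R^-1 * \sum_(n < N) cos (2 * pi * dot h (P n)).
Definition mean_sin N s (P : 'I_N -> s.-tuple R) (h : s.-tuple int) : R :=
  N%:R^-1 * \sum_(n < N) sin (2 * pi * dot h (P n)).
(* The squared modulus of the mean of [cis2pi (dot h x)] over the points [x] of [P]. *)
Definition expsum_sqr N s (P : 'I_N -> s.-tuple R) (h : s.-tuple int) : R :=
  mean_cos P h ^+ 2 + mean_sin P h ^+ 2.

(** Only [N] values of [f] enter the rule, so a single finite set of frequencies approximates all of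
    them within [e]. No infinite sum has to be exchanged with the quadrature. *)
Lemma quad_error_sum N s (P : 'I_N -> s.-tuple R) f (e : R) : (0 < N)%N -> 0 < e ->
  @abs_conv_fourier R s f -> exists A : {fset s.-tuple int}, zero_freq s \notin A /\
  `|quadrature P f - cube_integral f| <= e + `|\sum_(h <- enum_fset A)
     (complex.Re (fourier_coef f h) * mean_cos P h - complex.Im (fourier_coef f h) * mean_sin P h)|.
Proof.
move=> N0 e0 [_ _]; have := fourier_coef_zero f.
move: (fourier_coef f) => c cz fsum.
have FF := @summability.totally_filter (s.-tuple int).
have : \forall A \near summability.totally, (forall n : 'I_N,
   `|complex.Re (f (P n))%:C - \sum_(h <- enum_fset A) complex.Re (c h * cis2pi (dot h (P n)))| < e)
   /\ ([fset zero_freq s] `<=` A)%fset.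
  apply: filterI; last by exists [fset zero_freq s]%fset.
  have H := @filter_forall _ 'I_N _ summability.totally FF
    (fun n => has_sum_near_fset e0 (fsum (P n))).
  exact: H.
move=> /filter_ex[A [HA]]; rewrite fsub1set => zA.
exists (A `\ zero_freq s)%fset; split; first by rewrite !inE eqxx.
set B := (A `\ _)%fset.
(* The zero frequency contributes exactly the integral of [f] and cancels; what remains is the
   truncation error and the sum over [B]. *)
have E : quadrature P f - cube_integral f =
   N%:R^-1 * \sum_(n < N) (f (P n) - \sum_(h <- enum_fset A) complex.Re (c h * cis2pi (dot h (P n)))) +
   \sum_(h <- enum_fset B)
     (complex.Re (c h) * mean_cos P h - complex.Im (c h) * mean_sin P h).
  rewrite sumrB mulrBr -addrA; congr (_ + _); rewrite exchange_big /= mulr_sumr.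
  rewrite (big_fsetD1 _ zA) /= opprD -addrA -cz.
  have -> : N%:R^-1 * \sum_(i < N) complex.Re (c (zero_freq s) * cis2pi (dot (zero_freq s) (P i))) =
     complex.Re (c (zero_freq s)).
    rewrite (eq_bigr (fun=> complex.Re (c (zero_freq s)))); last first.
      by move=> n _; rewrite Re_mul_cis2pi dot_zero_freq mulr0 cos0 sin0 mulr1 mulr0 subr0.
    by rewrite sumr_const card_ord -[X in _ * X = _]mulr_natl mulKf// pnatr_eq0 -lt0n.
  rewrite -[LHS]addr0; congr (_ + _); apply/esym; rewrite addrC; apply/eqP; rewrite subr_eq0; apply/eqP.
  apply: eq_bigr => h _; rewrite /mean_cos /mean_sin.
  under [in RHS]eq_bigr do rewrite Re_mul_cis2pi.
  by rewrite sumrB -!mulr_sumr; ring.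
rewrite E; apply: (le_trans (ler_normD _ _)); rewrite lerD2r normrM ger0_norm ?invr_ge0//.
rewrite ler_pdivrMl ?ltr0n//; apply: (le_trans (ler_norm_sum _ _ _)).
apply: (@le_trans _ _ (\sum_(n < N) e)); first by apply: ler_sum => n _; apply/ltW/HA.
by rewrite sumr_const card_ord mulr_natl.
Qed.

(** Cauchy-Schwarz in linearized form, one frequency at a time: [r] will be the decay, and [t] is a
    parameter to be chosen close to the error bound. *)
Lemma amgm_cis (a b c d r t : R) : 0 < r -> 0 < t ->
  `|a * c - b * d| <= ((a ^+ 2 + b ^+ 2) / r * t + r * (c ^+ 2 + d ^+ 2) / t) / 2.
Proof.
move=> r0 t0; have H (e : R) : e ^+ 2 = 1 ->
   e * (a * c - b * d) <= ((a ^+ 2 + b ^+ 2) / r * t + r * (c ^+ 2 + d ^+ 2) / t) / 2.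
  move=> e1; rewrite -subr_ge0.
  (* An identity in [e]: two squares, and a term that vanishes when [e] is a sign. *)
  have -> : ((a ^+ 2 + b ^+ 2) / r * t + r * (c ^+ 2 + d ^+ 2) / t) / 2 - e * (a * c - b * d) =
     ((a * t - e * r * c) ^+ 2 + (b * t + e * r * d) ^+ 2) / (2 * r * t) +
     (1 - e ^+ 2) * (r * (c ^+ 2 + d ^+ 2) / (2 * t)).
    by field; rewrite !lt0r_neq0.
  rewrite e1 subrr mul0r addr0 divr_ge0 ?addr_ge0 ?sqr_ge0// ?mulr_ge0 ?(ltW r0) ?(ltW t0)//.
by rewrite ler_norml lerNl -mulN1r H ?sqrrN ?expr1n//= -[X in X <= _]mul1r H ?expr1n.
Qed.

Lemma decay_gt0 alpha gamma s (h : s.-tuple int) : (forall j, 0 < gamma j) ->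
  0 < decay alpha gamma h.
Proof.
move=> g0; apply: prodr_gt0 => j hj; rewrite divr_gt0// powR_gt0// normr_gt0.
by rewrite intr_eq0.
Qed.

Lemma sqnorm_fset_le1 alpha gamma s (f : s.-tuple R -> R) (A : {fset s.-tuple int}) :
  (forall j, 0 < gamma j) -> zero_freq s \notin A -> (korobov_norm alpha gamma f <= 1)%E ->
  \sum_(h <- enum_fset A) Normc.normc (fourier_coef f h) ^+ 2 / decay alpha gamma h <= 1.
Proof.
move=> g0 zA; rewrite /korobov_norm.
have -> : 1%E = sqrte (1%:E : \bar R) by rewrite /= sqrtr1.
rewrite lee_sqrt// /korobov_sqnorm -lee_fin; apply: le_trans.
rewrite -[leLHS]add0e; apply: leeD; first by rewrite lee_fin sqr_ge0.
apply: esum_ge; exists [set` A]; first split.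
- exact: finite_fset.
- by move=> h /= hA /eqP; apply/negP; apply: contraNneq zA => <-.
by rewrite fsbig_finite//= set_fsetK sumEFin.
Qed.

Lemma cube_integral_eq0 s (f : s.-tuple R -> R) : (forall x, f x = 0) -> cube_integral f = 0.
Proof. by move=> f0; rewrite /cube_integral /Rintegral integral0_eq// => x _; rewrite f0. Qed.

Lemma fourier_coef0 s (h : s.-tuple int) : fourier_coef (fun=> 0 : R) h = 0.
Proof.
rewrite /fourier_coef; congr (_ +i* _); apply: cube_integral_eq0 => x /=; ring.
Qed.

(** The zero function lies in the unit ball, so the supremum is not [-oo] and bounds on the error
    may be squared. *)
Lemma wce_ge0 alpha gamma N s (P : 'I_N -> s.-tuple R) :
  (0 <= worst_case_error alpha gamma P)%E.
Proof.
have nc0 : Normc.normc (0 : R[i]) = 0 by rewrite /= expr0n /= addr0 sqrtr0.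
have n0 : korobov_norm alpha gamma (fun=> 0 : R) = 0%E :> \bar R.
  move=> t; rewrite /korobov_norm /korobov_sqnorm esum1; last first.
    by move=> h _; rewrite fourier_coef0 nc0 expr0n mul0r.
  by rewrite fourier_coef0 nc0 expr0n adde0 /= sqrtr0.
apply: ereal_sup_ubound; exists (fun=> 0).
  split; last by rewrite /= n0.
  split; [by []| |by rewrite n0].
  split.
  - exact: integrable0.
  - by rewrite esum1 // => h _; rewrite fourier_coef0 nc0.
  - move=> x; have FF := @summability.totally_filter (s.-tuple int).
    apply/has_sumP => e e0; apply: nearW => A.
    by rewrite big1 ?subr0 ?normr0// => h _; rewrite fourier_coef0 mul0r.
rewrite /quadrature /cube_integral /Rintegral integral0 big1// mulr0 subr0 normr0//.
Qed.

Lemma wce_sqr_le alpha gamma N s (P : 'I_N -> s.-tuple R) : (0 < N)%N ->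
  (forall j, 0 < gamma j) ->
  (worst_case_error alpha gamma P ^+ 2 <=
   \esum_(h in ~` [set zero_freq s]) (decay alpha gamma h * expsum_sqr P h)%:E)%E.
Proof.
move=> N0 g0; set U := \esum_(h in _) _.
have U0 : (0 <= U)%E.
  by apply: esum_ge0 => h _; rewrite lee_fin mulr_ge0 ?(ltW (decay_gt0 _ _ _))// addr_ge0 ?sqr_ge0.
case EU : U U0 => [u||]// u0; last by rewrite leey.
rewrite lee_fin in u0.
suff H f : korobov_space alpha gamma f -> (korobov_norm alpha gamma f <= 1)%E ->
    `|quadrature P f - cube_integral f| <= Num.sqrt u.
  have : (worst_case_error alpha gamma P <= (Num.sqrt u)%:E)%E.
    by apply: ge_ereal_sup => _ [f [Hf nf] <-]; rewrite lee_fin H.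
  have : (0 <= worst_case_error alpha gamma P)%E.
    exact: wce_ge0.
  case: worst_case_error => // x; rewrite !lee_fin => x0 xs.
  by rewrite -expr2 -[leRHS]sqr_sqrtr// ler_sqr ?nnegrE ?sqrtr_ge0.
move=> [_ fac _] nf; apply/ler_addgt0Pr => e e0.
have e20 : 0 < e / 2 by rewrite divr_gt0.
have [A [zA HA]] := quad_error_sum P N0 e20 fac.
apply: le_trans HA _; rewrite [e in leRHS]splitr addrCA lerD2l.
apply: le_trans (ler_norm_sum _ _ _) _.
(* The optimal parameter would be [Num.sqrt u], which may be 0; the extra [e / 2] makes it
   positive. *)
set t := Num.sqrt u + e / 2.
have t0 : 0 < t by rewrite ltr_wpDl ?sqrtr_ge0.
apply: (@le_trans _ _ (\sum_(h <- enum_fset A)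
   ((Normc.normc (fourier_coef f h) ^+ 2 / decay alpha gamma h) * t + (decay alpha gamma h * expsum_sqr P h) / t) / 2)).
  apply: ler_sum => h _; rewrite sqr_normc; apply: amgm_cis => //; exact: decay_gt0.
rewrite -mulr_suml big_split /= -!mulr_suml ler_pdivrMr//.
rewrite -/t mulr_natr mulr2n; apply: lerD.
  by rewrite ler_piMl ?(ltW t0)//; exact: sqnorm_fset_le1.
rewrite ler_pdivrMr//; apply: (@le_trans _ _ u).
  rewrite -lee_fin -EU -sumEFin; apply: esum_ge; exists [set` A]; first split.
  - exact: finite_fset.
  - by move=> h /= hA /eqP; apply/negP; apply: contraNneq zA => <-.
  - by rewrite fsbig_finite//= set_fsetK.
have -> : u = Num.sqrt u * Num.sqrt u by rewrite -expr2 sqr_sqrtr.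
by apply: ler_pM; rewrite ?sqrtr_ge0// lerDl ltW.
Qed.

End worst_case_upper.

(** * Integrals of trigonometric polynomials over the cube *)

Section cube_cos.
Variable R : realType.
Local Notation leb := (@lebesgue_measure R).

Lemma cosD2piz (x : R) (k : int) : cos (x + 2 * pi * k%:~R) = cos x.
Proof.
have H (n : nat) (y : R) : cos (y + 2 * pi * n%:R) = cos y.
  elim: n => [|n IHn]; first by rewrite mulr0 addr0.
  have -> : y + 2 * pi * n.+1%:R = y + 2 * pi * n%:R + pi *+ 2.
    by rewrite -[n.+1%:R]natr1; ring.
  by rewrite cosD2pi IHn.
case: k => n; first by rewrite H.
rewrite NegzE mulrNz mulrN -[in RHS](subrK (2 * pi * n.+1%:R) x).
by rewrite H.
Qed.

Lemma sinD2piz (x : R) (k : int) : sin (x + 2 * pi * k%:~R) = sin x.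
Proof. by rewrite -[LHS]opprK -!cosDpihalf addrAC cosD2piz cosDpihalf opprK. Qed.

Lemma is_derive_sin_lin (b c x : R) : is_derive x 1 (fun t => sin (b * t + c)) (b * cos (b * x + c)).
Proof.
have d1 : is_derive x 1 (fun t : R => b * t + c) b.
  by apply: is_derive_eq; rewrite ?addr0 ?scaler0// -[LHS]/(b * 1) mulr1.
rewrite [b * cos _]mulrC.
have H := @is_derive1_comp _ sin (fun t : R => b * t + c) x _ _ (is_derive_sin (b * x + c)) d1.
exact: H.
Qed.

Lemma continuous_cos_lin (b c : R) : continuous (fun t : R => cos (b * t + c)).
Proof.
move=> x; apply: continuous_comp; last exact: continuous_cos.
by apply: cvgD; [apply: cvgM; [exact: cvg_cst|exact: cvg_id]|exact: cvg_cst].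
Qed.

Lemma integral_cos_itv (k : int) (c : R) :
  (\int[leb]_(x in `[0%R, 1%R[) (cos (2 * pi * (k%:~R * x) + c))%:E =
   (if k == 0 then cos c else 0)%:E)%E.
Proof.
have ctn : continuous (fun x : R => cos (2 * pi * (k%:~R * x) + c)).
  by move=> x; under eq_fun do rewrite mulrA; exact: continuous_cos_lin.
rewrite integral_itv_bndo_bndc; last first.
  apply/measurable_EFinP; apply: measurable_funTS.
  exact: continuous_measurable_fun.
have [->|k0] := eqVneq k 0.
  under eq_integral do rewrite mul0r mulr0 add0r.
  by rewrite integral_cst//= lebesgue_measure_itv/= lte01 oppr0 adde0 mule1.
have b0 : 2 * pi * k%:~R != 0 :> R by rewrite !mulf_neq0 ?intr_eq0// gt_eqF// pi_gt0.
pose F (x : R) := (2 * pi * k%:~R)^-1 * sin (2 * pi * k%:~R * x + c).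
have dF (x : R) : is_derive x (1 : R) F (cos (2 * pi * (k%:~R * x) + c)).
  have H := is_derive_sin_lin (2 * pi * k%:~R) c x.
  by apply: is_derive_eq; rewrite /GRing.scale/= mulKf// mulrA.
have cF : continuous F.
  by move=> x; apply: differentiable_continuous; apply/derivable1_diffP; exact: ex_derive.
rewrite (@continuous_FTC2 _ (fun x => cos (2 * pi * (k%:~R * x) + c)) F 0 1)//.
- rewrite -EFinB /F mulr1 mulr0 [_ + c]addrC sinD2piz add0r subrr//.
- exact: continuous_subspaceT.
- split.
  + by move=> x _; exact: ex_derive.
  + by apply: cvg_at_right_filter; exact: cF.
  + by apply: cvg_at_left_filter; exact: cF.
- by move=> x _; rewrite derive1E derive_val.
Qed.

Local Notation mu := (@lebesgue_tuple R).

Lemma unit_cube_cons n :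
  @cons_pair R n @^-1` (@unit_cube R n.+1) = `[0%R, 1%R[%classic `*` @unit_cube R n.
Proof.
apply/seteqP; split=> -[t x] /=.
  move=> H; split=> /=; first by rewrite in_itv /=; have := H ord0; rewrite tnth0.
  by move=> j; have := H (lift ord0 j); rewrite (tnth_nth 0) /= -tnth_nth.
move=> [/= + H] j; rewrite in_itv /= => t01.
case: (unliftP ord0 j) => [i ->|->]; last by rewrite tnth0.
by rewrite (tnth_nth 0) /= -tnth_nth.
Qed.

Lemma measurable_unit_cube n : measurable (@unit_cube R n).
Proof.
rewrite (_ : @unit_cube R n = \bigcap_(j in [set: 'I_n])
  ((fun x : n.-tuple R => tnth x j) @^-1` `[0%R, 1%R[%classic)).
  apply: fin_bigcap_measurable => [|j _]; first exact: finite_finset.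
  by rewrite -[X in measurable X]setTI; exact: measurable_tnth.
apply/seteqP; split=> x H j; first by move=> _; have := H j; rewrite /= in_itv.
by have := H j I; rewrite /= in_itv.
Qed.

Lemma leb01 : leb `[0%R, 1%R[%classic = 1%E.
Proof. by rewrite lebesgue_measure_itv /= lte01 oppr0 adde0. Qed.

Lemma lebesgue_tuple_unit_cube n : mu n (@unit_cube R n) = 1%E.
Proof.
elim: n => [|n IHn].
  rewrite /= diracE mem_set//; by move=> -[].
rewrite /= /lebesgue_cons /pushforward unit_cube_cons.
rewrite product_measure1E//; last exact: measurable_unit_cube.
by rewrite IHn mule1; exact: leb01.
Qed.

Lemma measurable_dot n (h : n.-tuple int) : measurable_fun setT (@dot R n h).
Proof.
apply: measurable_sum => j; apply: measurable_funM => //.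
exact: measurable_tnth.
Qed.

Lemma measurable_cos_dot n (h : n.-tuple int) c :
  measurable_fun setT (fun x : n.-tuple R => cos (2 * pi * dot h x + c)).
Proof.
have mc : measurable_fun setT (@cos R) by apply: continuous_measurable_fun; exact: continuous_cos.
apply: (measurableT_comp mc).
apply: measurable_funD => //; apply: measurable_funM => //; exact: measurable_dot.
Qed.

Lemma integrable_cube n (f : n.-tuple R -> R) (M : R) : measurable_fun setT f ->
  (forall x, `|f x| <= M) -> (mu n).-integrable (@unit_cube R n) (EFin \o f).
Proof.
move=> mf fM; apply: measurable_bounded_integrable.
- exact: measurable_unit_cube.
- by rewrite [X in (X < _)%E](_ : _ = 1%E) ?ltry//; exact: lebesgue_tuple_unit_cube.
- exact: measurable_funTS.
- exists M; split; first by rewrite num_real.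
  by move=> x Mx y _ /=; rewrite (le_trans (fM y))// ltW.
Qed.

(** Fubini's theorem for the recursively built measure: the integral is pulled back along
    [cons_pair], and the bound [M] on a set of measure 1 provides integrability. *)
Lemma integral_cube_cons n (f : n.+1.-tuple R -> R) (M : R) : measurable_fun setT f ->
  (forall x, `|f x| <= M) ->
  (\int[mu n.+1]_(x in @unit_cube R n.+1) (f x)%:E =
   \int[leb]_(t in `[0%R, 1%R[) \int[mu n]_(x in @unit_cube R n) (f (cons_pair (t, x)))%:E)%E.
Proof.
move=> mf fM.
have mD : measurable (`[0%R, 1%R[%classic `*` @unit_cube R n : set (R * n.-tuple R)).
  by apply: measurableX => //; exact: measurable_unit_cube.
have mg : measurable_fun setT (f \o @cons_pair R n).
  by apply: measurableT_comp => //; exact: measurable_cons_pair.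
have mD1 : (leb \x mu n)%E (`[0%R, 1%R[%classic `*` @unit_cube R n) = 1%E.
  rewrite product_measure1E//; last exact: measurable_unit_cube.
  by rewrite lebesgue_tuple_unit_cube mule1; exact: leb01.
have ig : (leb \x mu n)%E.-integrable (`[0%R, 1%R[%classic `*` @unit_cube R n) (EFin \o (f \o @cons_pair R n)).
  apply: measurable_bounded_integrable => //.
  - rewrite [X in (X < _)%E](_ : _ = 1%E) ?ltry//; exact: mD1.
  - exact: measurable_funTS.
  - exists M; split; first by rewrite num_real.
    by move=> x Mx y _ /=; rewrite (le_trans (fM _))// ltW.
have mc : measurable_fun [set: (measurableTypeR R * n.-tuple R)%type] (@cons_pair R n).
  exact: measurable_cons_pair.
have := @integral_pushforward _ _ _ _ R _ mc (leb \x mu n)%E (@unit_cube R n.+1) (EFin \o f).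
rewrite unit_cube_cons => -> //; last 2 first.
- exact/measurable_EFinP.
- exact: measurable_unit_cube.
rewrite integral_mkcond -integral12_prod_meas1; last first.
  by rewrite -integrable_restrict// setTI.
rewrite [RHS]integral_mkcond; apply: eq_integral => t _.
rewrite /fubini_F patchE; case: ifPn => ht.
  rewrite [RHS]integral_mkcond; apply: eq_integral => x _.
  rewrite !patchE /= in_setX ht /=; case: ifP => //.
by rewrite integral0_eq// => x _; rewrite patchE in_setX (negbTE ht).
Qed.

Lemma tnth_behead_lift (I : Type) n (h : n.+1.-tuple I) (j : 'I_n) :
  tnth [tuple of behead h] j = tnth h (lift ord0 j).
Proof.
by rewrite tnth_behead; congr tnth; apply: val_inj; rewrite /= inordK // ltnS.
Qed.

Lemma dot_cons n (h : n.+1.-tuple int) (t : R) (x : n.-tuple R) :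
  dot h (cons_pair (t, x)) = (thead h)%:~R * t + dot [tuple of behead h] x.
Proof.
rewrite /dot big_ord_recl tnth0 /thead; congr (_ + _); apply: eq_bigr => j _.
by rewrite -!tnth_behead_lift; congr (_ * tnth _ _); apply: val_inj.
Qed.

Lemma cons_zero_freq n (h : n.+1.-tuple int) :
  (h == zero_freq n.+1) = (thead h == 0) && ([tuple of behead h] == zero_freq n).
Proof.
apply/eqP/andP => [->|[/eqP h0 /eqP hb]].
  split; first by rewrite /thead tnth_mktuple.
  by apply/eqP/eq_from_tnth => j; rewrite tnth_behead_lift !tnth_mktuple.
apply: eq_from_tnth => j; rewrite tnth_mktuple.
case: (unliftP ord0 j) => [i ->|->]; last exact: h0.
by rewrite -tnth_behead_lift hb tnth_mktuple.
Qed.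

(** The phase [c] is left free for the induction: the first coordinate [t] adds
    [2 * pi * (thead h * t)] to it. Taking [c = pi / 2] later gives the sines. *)
Lemma integral_cube_cos n (h : n.-tuple int) (c : R) :
  (\int[mu n]_(x in @unit_cube R n) (cos (2 * pi * dot h x + c))%:E =
   (if h == zero_freq n then cos c else 0)%:E)%E.
Proof.
elim: n h c => [|n IHn] h c.
  rewrite integral_dirac//=; last 2 first.
  - exact: measurable_unit_cube.
  - by apply/measurable_EFinP/measurable_funTS; exact: measurable_cos_dot.
  rewrite diracE mem_set ?mul1e; last by move=> [].
  rewrite /dot big_ord0 mulr0 add0r (_ : _ == _)//.
  by apply/eqP; rewrite (tuple0 h) (tuple0 (zero_freq 0)).
rewrite (@integral_cube_cons _ _ 1); last 2 first.
- exact: measurable_cos_dot.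
- by move=> x; rewrite ler_norml cos_geN1 cos_le1.
rewrite cons_zero_freq.
under eq_integral => t _.
  rewrite (eq_integral (fun x => (cos (2 * pi * dot [tuple of behead h] x + (2 * pi * ((thead h)%:~R * t) + c)))%:E)); last first.
    by move=> x _; rewrite dot_cons mulrDr [_ + 2 * pi * dot _ _]addrC addrA.
  rewrite IHn; over.
rewrite [_ && _]andbC; case: (_ == zero_freq n) => /=; first exact: integral_cos_itv.
by rewrite integral0.
Qed.

Lemma integrable_cube_sum n (I : Type) (r : seq I) (f : I -> n.-tuple R -> R) :
  (forall i, (mu n).-integrable (@unit_cube R n) (EFin \o f i)) ->
  (mu n).-integrable (@unit_cube R n) (EFin \o (fun x => \sum_(i <- r) f i x)).
Proof.
move=> intf; have mD : measurable (@unit_cube R n) by exact: measurable_unit_cube.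
elim: r => [|j r IHr].
  apply: (eq_integrable mD (fun=> 0%E)); last exact: integrable0.
  by move=> x _ /=; rewrite big_nil.
apply: (eq_integrable mD ((EFin \o f j) \+ (EFin \o (fun x => \sum_(i <- r) f i x)%R))%E).
  by move=> x _ /=; rewrite big_cons EFinD.
exact: integrableD.
Qed.

Lemma cube_integral_sum n (I : Type) (r : seq I) (f : I -> n.-tuple R -> R) :
  (forall i, (mu n).-integrable (@unit_cube R n) (EFin \o f i)) ->
  cube_integral (fun x => \sum_(i <- r) f i x) = \sum_(i <- r) cube_integral (f i).
Proof.
have mD : measurable (@unit_cube R n) by exact: measurable_unit_cube.
move=> intf; elim: r => [|i r IHr].
  by rewrite big_nil cube_integral_eq0// => x; rewrite big_nil.
rewrite big_cons -IHr /cube_integral -RintegralD//; last exact: integrable_cube_sum.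
by apply: eq_Rintegral => x _; rewrite big_cons.
Qed.

Lemma integrable_cos_dot n (a : R) (m : n.-tuple int) (c : R) :
  (mu n).-integrable (@unit_cube R n) (EFin \o (fun x => a * cos (2 * pi * dot m x + c))).
Proof.
apply: (@integrable_cube _ _ `|a|).
  by apply: measurable_funM => //; exact: measurable_cos_dot.
move=> x; rewrite normrM -[leRHS]mulr1 ler_wpM2l// ler_norml.
by rewrite cos_geN1 cos_le1.
Qed.

Lemma cube_integral_cos n (a : R) (m : n.-tuple int) (c : R) :
  cube_integral (fun x => a * cos (2 * pi * dot m x + c)) =
  if m == zero_freq n then a * cos c else 0.
Proof.
rewrite /cube_integral RintegralZl.
- by rewrite /Rintegral integral_cube_cos; case: ifP => //=; rewrite mulr0.
- exact: measurable_unit_cube.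
- have := integrable_cos_dot 1 m c; congr (_.-integrable _ _).
  by apply/funext => x /=; rewrite mul1r.
Qed.

Definition opp_freq n (h : n.-tuple int) : n.-tuple int := [tuple - tnth h j | j < n].
Definition add_freq n (h k : n.-tuple int) : n.-tuple int := [tuple tnth h j + tnth k j | j < n].

Lemma dot_add_freq n (h k : n.-tuple int) (x : n.-tuple R) : dot (add_freq h k) x = dot h x + dot k x.
Proof.
by rewrite /dot -big_split; apply: eq_bigr => j _; rewrite tnth_mktuple intrD mulrDl.
Qed.

Lemma dot_opp_freq n (h : n.-tuple int) (x : n.-tuple R) : dot (opp_freq h) x = - dot h x.
Proof.
by rewrite /dot -sumrN; apply: eq_bigr => j _; rewrite tnth_mktuple mulrNz mulNr.
Qed.

Lemma opp_freqK n : involutive (@opp_freq n).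
Proof. by move=> h; apply: eq_from_tnth => j; rewrite !tnth_mktuple opprK. Qed.

Lemma add_freq_eq0 n (h k : n.-tuple int) : (add_freq h k == zero_freq n) = (h == opp_freq k).
Proof.
apply/eqP/eqP => [e|->]; apply: eq_from_tnth => j; rewrite !tnth_mktuple; last exact: addNr.
have := congr1 (fun t => tnth t j) e; rewrite /= !tnth_mktuple => /eqP.
by rewrite addr_eq0 => /eqP.
Qed.

Lemma dual_opp_freq n N z (h : n.-tuple int) : dual N z h -> dual N z (opp_freq h).
Proof.
rewrite /dual /= /int_dot => H.
rewrite (eq_bigr (fun j => - (tnth h j * (z j)%:Z))) ?sumrN; first by rewrite rpredN.
by move=> j _; rewrite tnth_mktuple mulNr.
Qed.

Lemma decay_opp_freq alpha gamma n (h : n.-tuple int) : decay alpha gamma (opp_freq h) = decay alpha gamma h :> R.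
Proof.
rewrite /decay; apply: eq_big => j; rewrite tnth_mktuple ?oppr_eq0//.
by rewrite mulrNz normrN.
Qed.

Section trig_poly.
Variables (n : nat) (F : {fset n.-tuple int}) (a : n.-tuple int -> R).
Hypotheses (F0 : zero_freq n \notin F) (FN : forall h, h \in F -> opp_freq h \in F)
  (aN : forall h, a (opp_freq h) = a h).

(** As [F] and [a] are invariant under [opp_freq], the exponential sum with coefficients [a k] is
    real and equals this cosine sum; its Fourier coefficients are therefore the [a k] themselves. *)
Definition trig_poly (x : n.-tuple R) : R :=
  \sum_(k <- enum_fset F) a k * cos (2 * pi * dot k x).

Lemma mem_opp_freq h : (opp_freq h \in F) = (h \in F).
Proof. by apply/idP/idP => [/FN|/FN//]; rewrite opp_freqK. Qed.

Lemma sum_fset_pick (h : n.-tuple int) (b : n.-tuple int -> R) :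
  \sum_(k <- enum_fset F) (if k == h then b k else 0) = if h \in F then b h else 0.
Proof.
rewrite -big_mkcond; case: ifPn => hF.
  by rewrite -big_filter filter_pred1_uniq ?fset_uniq// big_seq1.
rewrite big_seq_cond big_pred0// => k; apply/negP => /andP[kF /eqP kh].
by rewrite -kh kF in hF.
Qed.

(** The product-to-sum formula leaves pure cosines, of which only those with [k = opp_freq h] and
    [k = h] have a non-zero integral, each with coefficient [a k / 2]; the symmetry of [F] and [a]
    merges the two halves. *)
Lemma cube_integral_trig_poly (h : n.-tuple int) (c : R) :
  cube_integral (fun x => trig_poly x * cos (2 * pi * dot h x + c)) =
  if h \in F then a h * cos c else 0.
Proof.
pose p (k : n.-tuple int) := [:: (add_freq k h, c); (add_freq k (opp_freq h), - c)].
pose q k i (x : n.-tuple R) := a k / 2 * cos (2 * pi * dot i.1 x + i.2).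
have E : (fun x => trig_poly x * cos (2 * pi * dot h x + c)) =
    (fun x => \sum_(k <- enum_fset F) \sum_(i <- p k) q k i x).
  apply/funext => x; rewrite /trig_poly mulr_suml; apply: eq_bigr => k _.
  rewrite /p big_cons big_seq1 /q /= !dot_add_freq dot_opp_freq.
  set u := 2 * pi * dot k x; set v := 2 * pi * dot h x + c.
  have -> : 2 * pi * (dot k x + dot h x) + c = u + v by rewrite /u /v; ring.
  have -> : 2 * pi * (dot k x - dot h x) - c = u - v by rewrite /u /v; ring.
  by clearbody u v; rewrite cosD cosB; field.
have intq k i : (mu n).-integrable (@unit_cube R n) (EFin \o q k i).
  exact: integrable_cos_dot.
rewrite E (@cube_integral_sum _ _ (enum_fset F) (fun k x => \sum_(i <- p k) q k i x)); last first.
  by move=> k; exact: integrable_cube_sum.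
under eq_bigr => k _.
  rewrite cube_integral_sum// /p big_cons big_seq1 !cube_integral_cos !add_freq_eq0 opp_freqK cosN.
  over.
rewrite big_split /= !sum_fset_pick mem_opp_freq aN; case: ifP; last by rewrite addr0.
by move=> _; field.
Qed.

Lemma fourier_coef_trig_poly h : fourier_coef trig_poly h = (if h \in F then a h else 0)%:C.
Proof.
rewrite /fourier_coef; congr (_ +i* _).
  rewrite (_ : cube_integral _ = cube_integral (fun x => trig_poly x * cos (2 * pi * dot h x + 0))).
    by rewrite cube_integral_trig_poly cos0 mulr1.
  by congr cube_integral; apply/funext => x /=; rewrite mulrN cosN mul0r subr0 addr0.
rewrite (_ : cube_integral _ = cube_integral (fun x => trig_poly x * cos (2 * pi * dot h x + pi / 2))).
  by rewrite cube_integral_trig_poly cos_pihalf mulr0 if_same.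
by congr cube_integral; apply/funext => x /=; rewrite mulrN sinN cosDpihalf mul0r addr0.
Qed.

Lemma normc_real (x : R) : Normc.normc x%:C ^+ 2 = x ^+ 2.
Proof. by rewrite sqr_normc /= expr0n addr0. Qed.

Lemma trig_poly_periodic : periodic trig_poly.
Proof.
move=> x k; apply: eq_bigr => h _; congr (_ * _).
rewrite -[RHS](cosD2piz _ (\sum_(j < n) tnth h j * tnth k j)); congr cos.
rewrite -mulrDr; congr (_ * _); rewrite /dot rmorph_sum -big_split /=.
by apply: eq_bigr => j _; rewrite tnth_mktuple mulrDr intrM.
Qed.

(** Opposite frequencies cancel, [a] being even and the sine odd. This is the vanishing of the
    imaginary part of the Fourier series. *)
Lemma trig_poly_sin0 (x : n.-tuple R) :
  \sum_(k <- enum_fset F) a k * sin (2 * pi * dot k x) = 0.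
Proof.
set S := \sum_(k <- _) _.
suff : S = - S by move/eqP; rewrite -addr_eq0 -mulr2n mulrn_eq0 /= => /eqP.
rewrite {1}/S (perm_big (map (@opp_freq n) (enum_fset F))) /=; last first.
  have injN : injective (@opp_freq n) := can_inj (@opp_freqK n).
  apply: uniq_perm; [exact: fset_uniq|by rewrite (map_inj_uniq injN) fset_uniq|].
  by move=> h; rewrite -[in RHS](opp_freqK h) (mem_map injN) mem_opp_freq.
rewrite big_map -sumrN; apply: eq_bigr => k _.
by rewrite aN dot_opp_freq mulrN sinN mulrN.
Qed.

Lemma Im_sum (I : Type) (r : seq I) (G : I -> R[i]) :
  complex.Im (\sum_(i <- r) G i) = \sum_(i <- r) complex.Im (G i).
Proof. by elim: r => [|i r IHr]; rewrite ?big_nil// !big_cons -IHr; case: (G i) => ? ?;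
  case: (\sum_(_ <- r) _). Qed.

Lemma trig_poly_has_sum (x : n.-tuple R) :
  has_sum (fun h => fourier_coef trig_poly h * cis2pi (dot h x)) (trig_poly x)%:C.
Proof.
have FF := @summability.totally_filter (n.-tuple int).
apply/has_sumP => e e0.
have : \forall A \near summability.totally, (F `<=` A)%fset by exists F.
apply: filterS => A FA.
suff -> : \sum_(h <- enum_fset A) fourier_coef trig_poly h * cis2pi (dot h x) = (trig_poly x)%:C.
  by rewrite subrr normr0.
rewrite -(big_fset_incl _ FA); last first.
  by move=> h _ /negbTE hF; rewrite fourier_coef_trig_poly hF mul0r.
apply/eqP; rewrite eq_complex Re_sum Im_sum; apply/andP; split; apply/eqP.
  rewrite [RHS](_ : _ = \sum_(k <- enum_fset F) a k * cos (2 * pi * dot k x))//.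
  rewrite [RHS]big_seq_cond [LHS]big_seq_cond; apply: eq_bigr => h /andP[hF _].
  by rewrite fourier_coef_trig_poly hF /= mul0r subr0.
rewrite [RHS]/= -[RHS](trig_poly_sin0 x) [RHS]big_seq_cond [LHS]big_seq_cond;
  apply: eq_bigr => h /andP[hF _].
by rewrite fourier_coef_trig_poly hF /= mul0r addr0.
Qed.

Lemma trig_poly_abs_conv : abs_conv_fourier trig_poly.
Proof.
split; last exact: trig_poly_has_sum.
- rewrite (_ : trig_poly = fun x => \sum_(k <- enum_fset F) a k * cos (2 * pi * dot k x + 0)).
    by apply: integrable_cube_sum => k; exact: integrable_cos_dot.
  by apply/funext => x; apply: eq_bigr => k _; rewrite addr0.
- rewrite (esumID [set` F]); last by move=> h _; rewrite lee_fin; case: (fourier_coef _ _) => ? ?;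
    exact: sqrtr_ge0.
  rewrite [X in (_ + X)%E]esum1 ?adde0; last first.
    move=> h [_ hF]; have {}hF : (h \in F) = false by apply/negP.
    rewrite fourier_coef_trig_poly hF /=.
    by rewrite expr0n addr0 sqrtr0.
  rewrite setTI esum_fset; last 2 first.
  + exact: finite_fset.
  + by move=> h _; rewrite lee_fin; case: (fourier_coef _ _) => ? ?; exact: sqrtr_ge0.
  by rewrite fsbig_finite//= sumEFin ltry.
Qed.

Lemma korobov_sqnorm_trig_poly alpha gamma : (forall j, 0 < gamma j) ->
  korobov_sqnorm alpha gamma trig_poly =
  (\sum_(h <- enum_fset F) a h ^+ 2 / decay alpha gamma h)%:E.
Proof.
move=> g0; rewrite /korobov_sqnorm fourier_coef_trig_poly (negbTE F0) normc_real expr0n add0e.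
rewrite (esumID [set` F]); last first.
  by move=> h _; rewrite lee_fin divr_ge0 ?sqr_ge0// ltW// decay_gt0.
rewrite [X in (_ + X)%E]esum1 ?adde0; last first.
  move=> h [_ hF]; have {}hF : (h \in F) = false by apply/negP.
    rewrite fourier_coef_trig_poly hF normc_real.
  by rewrite expr0n mul0r.
rewrite (_ : _ `&` _ = [set` F]); last first.
  apply/seteqP; split=> [h []//|h hF]; split=> //= h0.
  by move: F0; rewrite -h0 hF.
rewrite esum_fset; last 2 first.
- exact: finite_fset.
- by move=> h _; rewrite lee_fin divr_ge0 ?sqr_ge0// ltW// decay_gt0.
rewrite fsbig_finite// set_fsetK sumEFin; congr (_%:E).
rewrite [RHS]big_seq_cond [LHS]big_seq_cond; apply: eq_bigr => h /andP[hF _].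
by rewrite fourier_coef_trig_poly hF normc_real.
Qed.

End trig_poly.
End cube_cos.

(** * Worst-case error of lattice rules *)

Section lattice.
Variable R : realType.
Implicit Types (alpha : R) (gamma : nat -> R).

(** Taking fractional parts shifts the phase by an integer, which neither cosine nor sine of
    [2 * pi] times it can see. *)
Lemma dot_lattice N d (z : nat -> nat) (n : 'I_N) (h : d.-tuple int) :
  exists m : int, dot h (lattice_points (fun j : 'I_d => z j) n) =
    n%:R * ((int_dot z h)%:~R / N%:R) + m%:~R :> R.
Proof.
exists (- \sum_(j < d) tnth h j * Num.floor ((n * z j)%:R / N%:R : R)).
rewrite /dot mulrNz /int_dot !rmorph_sum /= mulr_suml mulr_sumr -sumrB.
apply: eq_bigr => j _; rewrite tnth_mktuple /frac mulrBr !intrM natrM -!pmulrn; congr (_ - _).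
by ring.
Qed.

Lemma cos_dot_lattice N d (z : nat -> nat) (n : 'I_N) (h : d.-tuple int) :
  cos (2 * pi * dot h (lattice_points (fun j : 'I_d => z j) n)) =
  cos (2 * pi * (n%:R * ((int_dot z h)%:~R / N%:R))) :> R.
Proof. by have [m ->] := dot_lattice z n h; rewrite mulrDr cosD2piz. Qed.

Lemma sin_dot_lattice N d (z : nat -> nat) (n : 'I_N) (h : d.-tuple int) :
  sin (2 * pi * dot h (lattice_points (fun j : 'I_d => z j) n)) =
  sin (2 * pi * (n%:R * ((int_dot z h)%:~R / N%:R))) :> R.
Proof. by have [m ->] := dot_lattice z n h; rewrite mulrDr sinD2piz. Qed.

Lemma dual_quotient N d (z : nat -> nat) (h : d.-tuple int) : (0 < N)%N -> dual N z h ->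
  exists m : int, (int_dot z h)%:~R / N%:R = m%:~R :> R.
Proof.
move=> N0 /(@dvdzP N) [m ->]; exists m; rewrite intrM -pmulrn mulfK//.
by rewrite pnatr_eq0 -lt0n.
Qed.

Lemma cos_dot_dual N d (z : nat -> nat) (n : 'I_N) (h : d.-tuple int) : dual N z h ->
  cos (2 * pi * dot h (lattice_points (fun j : 'I_d => z j) n)) = 1 :> R.
Proof.
move=> hd; have N0 : (0 < N)%N by case: (N) n => [[]|].
have [m mE] := dual_quotient N0 hd.
rewrite cos_dot_lattice mE -[n%:R]/((Posz n)%:~R) -intrM.
by rewrite -[2 * pi * _]add0r cosD2piz cos0.
Qed.

Lemma sin_dot_dual N d (z : nat -> nat) (n : 'I_N) (h : d.-tuple int) : dual N z h ->
  sin (2 * pi * dot h (lattice_points (fun j : 'I_d => z j) n)) = 0 :> R.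
Proof.
move=> hd; have N0 : (0 < N)%N by case: (N) n => [[]|].
have [m mE] := dual_quotient N0 hd.
rewrite sin_dot_lattice mE -[n%:R]/((Posz n)%:~R) -intrM.
by rewrite -[2 * pi * _]add0r sinD2piz sin0.
Qed.

Lemma cis2piD (x y : R) : cis2pi (x + y) = cis2pi x * cis2pi y.
Proof.
apply/eqP; rewrite eq_complex /= mulrDr cosD sinD eqxx /=.
by apply/eqP; ring.
Qed.

Lemma cis2piX (x : R) n : cis2pi (n%:R * x) = cis2pi x ^+ n.
Proof.
elim: n => [|n IHn]; first by rewrite mul0r expr0 /cis2pi mulr0 cos0 sin0.
by rewrite -natr1 mulrDl mul1r cis2piD IHn exprSr.
Qed.

Lemma sum_roots_of_unity N (b : int) : (0 < N)%N -> ~~ (N %| b)%Z ->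
  \sum_(n < N) cis2pi (n%:R * (b%:~R / N%:R)) = 0 :> R[i].
Proof.
move=> N0 Nb; have Nn0 : N%:R != 0 :> R by rewrite pnatr_eq0 -lt0n.
set w := cis2pi (b%:~R / N%:R : R).
have wN : w ^+ N = 1.
  rewrite -cis2piX mulrC divfK//.
  by rewrite /cis2pi -[2 * pi * _]add0r cosD2piz sinD2piz cos0 sin0.
have w1 : w != 1.
  apply: contraNneq Nb => /(congr1 (@complex.Re R)) /=.
  have Nz : N%:Z != 0 by rewrite eqz_nat -lt0n.
  have mN : (b %% N < N)%Z by apply: ltz_pmod.
  move: (b %/ N)%Z (b %% N)%Z (divz_eq b N) (modz_ge0 b Nz) mN => q m -> m0 mN.
  have -> : (q * N + m)%:~R / N%:R = m%:~R / N%:R + q%:~R :> R.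
    by rewrite intrD intrM -[N%:~R]/(N%:R); field.
  rewrite mulrDr cosD2piz => cos1.
  have [m00|m00] := eqVneq m 0; first by rewrite m00 addr0 dvdz_mull.
  exfalso.
  have Nr : 0 < N%:R :> R by rewrite ltr0n.
  (* The angle is [t + t] with [t] strictly between 0 and [pi], so its cosine [1 - 2 * sin t ^ 2]
     cannot be 1. *)
  set t : R := pi * (m%:~R / N%:R).
  have t0 : 0 < sin t.
    apply: sin_gt0_pi; apply/andP; split.
      by rewrite /t mulr_gt0 ?pi_gt0// divr_gt0// ltr0z lt_neqAle eq_sym m00.
    rewrite /t -[ltRHS]mulr1 ltr_pM2l ?pi_gt0// ltr_pdivrMr// mul1r.
    by rewrite pmulrn ltr_int.
  have : cos (t + t) = 1 by rewrite -cos1; congr cos; rewrite /t; ring.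
  rewrite cosD -!expr2 cos2sin2 => H.
  have : sin t ^+ 2 = 0 by lra.
  by move/eqP; rewrite expf_eq0 /= gt_eqF.
apply: (mulfI (x := w - 1)); first by rewrite subr_eq0.
rewrite mulr0 (eq_bigr (fun n : 'I_N => w ^+ n)); last by move=> n _; rewrite cis2piX.
by rewrite -subrX1 wN subrr.
Qed.

Lemma sum_cos_sin N (b : int) : (0 < N)%N -> ~~ (N %| b)%Z ->
  \sum_(n < N) cos (2 * pi * (n%:R * (b%:~R / N%:R))) = 0 :> R /\
  \sum_(n < N) sin (2 * pi * (n%:R * (b%:~R / N%:R))) = 0 :> R.
Proof.
move=> N0 Nb; have H := sum_roots_of_unity N0 Nb; split.
  by have := congr1 (@complex.Re R) H; rewrite Re_sum.
by have := congr1 (@complex.Im R) H; rewrite Im_sum.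
Qed.

Lemma expsum_sqr_lattice N d (z : nat -> nat) (h : d.-tuple int) : (0 < N)%N ->
  expsum_sqr (lattice_points (N := N) (fun j : 'I_d => z j)) h = if (N %| int_dot z h)%Z then 1 else 0 :> R.
Proof.
move=> N0; rewrite /expsum_sqr /mean_cos /mean_sin; case: ifPn => hd.
  under eq_bigr do rewrite cos_dot_dual//.
  under [X in _ + (_ * X) ^+ 2]eq_bigr do rewrite sin_dot_dual//.
  rewrite sumr_const card_ord mulVf ?pnatr_eq0 -?lt0n// big1// mulr0 expr1n expr0n addr0//.
under eq_bigr do rewrite cos_dot_lattice.
under [X in _ + (_ * X) ^+ 2]eq_bigr do rewrite sin_dot_lattice.
have [-> ->] := sum_cos_sin N0 hd.
by rewrite !mulr0 expr0n addr0.
Qed.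

(* On the dual lattice the rule integrates no frequency correctly, so the
   trigonometric polynomial with coefficients [decay / sqrt V] has norm 1 and
   error [sqrt V], where [V] is the left-hand side. *)
Lemma sum_decay_le_wce alpha gamma N d (z : nat -> nat) (F : {fset d.-tuple int}) :
  (0 < N)%N -> (forall j, 0 < gamma j) -> zero_freq d \notin F ->
  (forall h, h \in F -> opp_freq h \in F) -> (forall h, h \in F -> dual N z h) ->
  ((\sum_(h <- enum_fset F) decay alpha gamma h)%:E <=
   worst_case_error alpha gamma (lattice_points (N := N) (fun j : 'I_d => z j)) ^+ 2)%E.
Proof.
move=> N0 g0 F0 FN Fd; set V := \sum_(h <- _) _.
have V0 : 0 <= V by apply: sumr_ge0 => h _; apply/ltW/decay_gt0.
have [->|Vn0] := eqVneq V 0; first by apply: sqre_ge0.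
have Vp : 0 < V by rewrite lt_neqAle eq_sym Vn0.
pose a (h : d.-tuple int) := decay alpha gamma h / Num.sqrt V.
have aN h : a (opp_freq h) = a h by rewrite /a decay_opp_freq.
have nf : (korobov_norm alpha gamma (trig_poly F a) <= 1)%E.
  rewrite /korobov_norm korobov_sqnorm_trig_poly// (_ : \sum_(h <- _) _ = 1) /= ?sqrtr1//.
  rewrite (eq_bigr (fun h => V^-1 * decay alpha gamma h)); last first.
    move=> h _; rewrite /a exprMn exprVn sqr_sqrtr//.
    have := decay_gt0 alpha h g0; move: (decay _ _ _) => r r0.
    by field; rewrite Vn0 gt_eqF.
  by rewrite -mulr_sumr mulVf.
have wle : ((Num.sqrt V)%:E <= worst_case_error alpha gamma (lattice_points (N := N) (fun j : 'I_d => z j)))%E.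
  apply: ereal_sup_ubound; exists (trig_poly F a).
    split=> //=; split; last by rewrite (le_lt_trans nf)// ltry.
      exact: trig_poly_periodic.
    exact: trig_poly_abs_conv.
  congr (_%:E); rewrite -fourier_coef_zero fourier_coef_trig_poly// (negbTE F0) subr0.
  rewrite /quadrature (eq_bigr (fun=> Num.sqrt V)).
    rewrite sumr_const card_ord -[X in _ * X]mulr_natl mulKf ?pnatr_eq0 -?lt0n//.
    by rewrite ger0_norm ?sqrtr_ge0.
  move=> n _; rewrite /trig_poly big_seq_cond.
  rewrite (eq_bigr (fun h => (Num.sqrt V)^-1 * decay alpha gamma h)); last first.
    by move=> h /andP[hF _]; rewrite cos_dot_dual ?mulr1 1?mulrC//; exact: Fd.
  rewrite -big_seq_cond -mulr_sumr -/V -{2}(sqr_sqrtr V0) expr2 mulKf//.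
  by rewrite gt_eqF// sqrtr_gt0.
case: (worst_case_error _ _ _) wle => [x| |]//; rewrite ?leey ?lee_fin => // xV.
rewrite -[leLHS]sqr_sqrtr// expr2.
by apply: ler_pM; rewrite ?sqrtr_ge0.
Qed.

(** Equality, and not just an upper bound, is what translates a minimizer of the error into a
    minimizer of [dual_incr]. The lower bound is obtained for finite sets of frequencies and passes
    to the supremum. *)
Lemma wce_lattice alpha gamma N d (z : nat -> nat) : (0 < N)%N -> (forall j, 0 < gamma j) ->
  (worst_case_error alpha gamma (lattice_points (N := N) (fun j : 'I_d => z j)) ^+ 2 =
   \esum_(h in dual N z `&` ~` [set zero_freq d]) (decays (2 * alpha) gamma h)%:E)%E.
Proof.
move=> N0 g0; apply/eqP; rewrite eq_le; apply/andP; split.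
  apply: (le_trans (wce_sqr_le _ _ N0 g0)).
  rewrite [leRHS]esum_mkcondl; apply: le_esum => h _;
    rewrite expsum_sqr_lattice// decayE /dual mem_set_bool.
  by case: ifP; rewrite ?mulr1 ?mulr0.
apply: ge_ereal_sup => _ [X [finX XD] <-].
(* Adjoining the opposite frequencies stays within the dual lattice, can only increase the sum, and
   gives the symmetry that a real polynomial needs. *)
pose A := fset_set X; pose F := (A `|` [fset opp_freq h | h in A])%fset.
have AX h : h \in A -> X h by rewrite in_fset_set// inE.
have Fdual h : h \in F -> dual N z h /\ h != zero_freq d.
  rewrite inE => /orP[/AX/XD[? /eqP]//|/imfsetP[k /AX/XD[kd /eqP k0] ->]].
  split; first exact: dual_opp_freq.
  apply: contra_neq k0 => /(congr1 (@opp_freq d)); rewrite opp_freqK => ->.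
  by apply: eq_from_tnth => j; rewrite !tnth_mktuple oppr0.
apply: le_trans (sum_decay_le_wce alpha N0 g0 _ _ (fun h hF => (Fdual h hF).1)); last 2 first.
- by apply/negP => /Fdual[_]; rewrite eqxx.
- move=> h; rewrite !inE => /orP[hA|/imfsetP[k kA ->]]; last by rewrite opp_freqK kA.
  by apply/orP; right; apply/imfsetP; exists h.
rewrite fsbig_finite//= sumEFin lee_fin.
have AF : (A `<=` F)%fset by exact: fsubsetUl.
rewrite (eq_big_seq (fun h => if h \in A then decay alpha gamma h else 0)); last first.
  by move=> h hA; rewrite hA decayE.
rewrite (big_fset_incl _ AF); last by move=> h _ /negbTE ->.
by apply: ler_sum => h _; case: ifP => // _; apply/ltW/decay_gt0.
Qed.

End lattice.

(** * Independence and expectations *)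

Section independence.
Context (dT : measure_display) (T : measurableType dT) (R : realType) (P : probability T R).
Context (d' : measure_display) (T' : measurableType d') (Y : T -> T').
Hypothesis mY : measurable_fun setT Y.
Import HBNNSimple.
Local Open Scope ereal_scope.

Lemma integral_mul_nnsfun_comp (G : T -> R) (f : {nnsfun T' >-> R}) :
  measurable_fun setT G -> (forall x, 0 <= G x)%R ->
  \int[P]_x (G x * f (Y x))%:E =
  \sum_(k \in range f) (k%:E * \int[P]_(x in Y @^-1` (f @^-1` [set k])) (G x)%:E).
Proof.
move=> mG G0.
have mpre k : measurable (Y @^-1` (f @^-1` [set k])).
  by rewrite -[X in measurable X]setTI; exact: mY.
under eq_integral do rewrite fimfunE EFinM -fsumEFin//.
under eq_integral => x _.
  rewrite ge0_mule_fsumr; last by move=> k; exact: nnfun_muleindic_ge0.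
  over.
rewrite ge0_integral_fsum//; last 2 first.
- move=> k; apply: emeasurable_funM; first exact/measurable_EFinP.
  apply/measurable_EFinP; apply: measurable_funM => //.
  by apply: measurableT_comp; last exact: mY.
- by move=> k x _; rewrite mule_ge0 ?lee_fin// -?lee_fin ?nnfun_muleindic_ge0.
apply: eq_fsbigr => k /set_mem [y _ fyk].
rewrite -ge0_integralZl//; last 3 first.
- exact/measurable_EFinP/measurable_funTS.
- by move=> x _; rewrite lee_fin.
- by rewrite lee_fin -fyk.
rewrite [RHS]integral_mkcond; apply: eq_integral => x _.
rewrite patchE /= indicE.
have -> : (Y x \in f @^-1` [set k]) = (x \in Y @^-1` (f @^-1` [set k])) by [].
by case: ifP => _; rewrite ?mulr1 ?mulr0 ?mule0// muleC.
Qed.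

(** The factorization is assumed for events [Y @^-1 A]; it extends to simple functions by linearity
    and to non-negative [u] by monotone convergence, applied with [K = G] and with [K = 1]. *)
Lemma ge0_integral_mul_comp (G : T -> R) (c : R) (u : T' -> R) :
  measurable_fun setT G -> (forall x, 0 <= G x)%R -> (0 <= c)%R ->
  (forall A, measurable A -> \int[P]_(x in Y @^-1` A) (G x)%:E = c%:E * P (Y @^-1` A)) ->
  measurable_fun setT u -> (forall y, 0 <= u y)%R ->
  \int[P]_x (G x * u (Y x))%:E = c%:E * \int[P]_x (u (Y x))%:E.
Proof.
move=> mG G0 c0 H mu u0.
have mEu : measurable_fun setT (EFin \o u) by exact/measurable_EFinP.
have u0' y : setT y -> 0 <= (EFin \o u) y by rewrite lee_fin.
pose f := nnsfun_approx measurableT mEu.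
have approx (K : T -> R) : measurable_fun setT K -> (forall x, 0 <= K x)%R ->
    \int[P]_x (K x * u (Y x))%:E = limn (fun n => \int[P]_x (K x * f n (Y x))%:E).
  move=> mK K0; rewrite -monotone_convergence//.
  - apply: eq_integral => x _; apply/esym/cvg_lim => //.
    under eq_fun do rewrite EFinM.
    by rewrite EFinM; apply: cvgeZl => //; exact: (cvg_nnsfun_approx measurableT mEu u0').
  - move=> n; apply/measurable_EFinP; apply: measurable_funM => //.
    exact: measurableT_comp.
  - by move=> n x _; rewrite lee_fin mulr_ge0.
  - move=> x _ m n mn; rewrite lee_fin ler_wpM2l//.
    exact/lefP/nd_nnsfun_approx.
rewrite approx//.
have -> : \int[P]_x (u (Y x))%:E = \int[P]_x (1 * u (Y x))%:E.
  by apply: eq_integral => x _; rewrite mul1r.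
rewrite (approx (fun=> 1%R))// -limeMl//; last first.
  apply: ereal_nondecreasing_is_cvgn => m n mn; apply: ge0_le_integral => //=.
  - by move=> x _; rewrite lee_fin mulr_ge0.
  - by apply/measurable_EFinP; apply: measurable_funM => //; exact: measurableT_comp.
  - by apply/measurable_EFinP; apply: measurable_funM => //; exact: measurableT_comp.
  - by move=> x _; rewrite lee_fin !mul1r; exact/lefP/nd_nnsfun_approx.
congr (limn _); apply/funext => n; rewrite !integral_mul_nnsfun_comp//.
rewrite ge0_mule_fsumr; last first.
  move=> k; have [k0|k0] := leP 0%R k.
    by rewrite mule_ge0 ?lee_fin// integral_ge0.
  by rewrite preimage_nnfun0// preimage_set0 integral_set0 mule0.
apply: eq_fsbigr => k _; rewrite H//.
rewrite [RHS]muleCA; congr (_ * (_ * _)).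
rewrite (integral_cst _ _ 1%E) ?mul1e//.
by rewrite -[X in measurable X]setTI; exact: mY.
Qed.

Local Close Scope ereal_scope.
Local Open Scope ring_scope.

(** A class of functions integrable for every probability and closed under sums and products, so
    that integrability of the many trigonometric integrands need not be rechecked. *)
Definition bounded_mfun (f : T -> R) :=
  measurable_fun setT f /\ exists M : R, forall x, `|f x| <= M.

Lemma bounded_mfun_integrable f : bounded_mfun f -> P.-integrable setT (EFin \o f).
Proof.
move=> [mf [M fM]]; apply: measurable_bounded_integrable => //.
  by rewrite (le_lt_trans (probability_le1 _ _)) ?ltry.
by exists M; split=> [|x x1 y _]; rewrite ?num_real//= (le_trans (fM y)) ?ltW.
Qed.

Lemma bounded_mfun_integral f : bounded_mfun f -> (\int[P]_x (f x)%:E)%E = (\int[P]_x f x)%:E.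
Proof. by move=> /bounded_mfun_integrable fi; rewrite fineK//; exact: integrable_fin_num. Qed.

Lemma bounded_mfunM f g : bounded_mfun f -> bounded_mfun g -> bounded_mfun (fun x => f x * g x).
Proof.
move=> [mf [M fM]] [mg [M' gM]]; split; first exact: measurable_funM.
by exists (M * M') => x; rewrite normrM ler_pM.
Qed.

Lemma bounded_mfunD f g : bounded_mfun f -> bounded_mfun g -> bounded_mfun (fun x => f x + g x).
Proof.
move=> [mf [M fM]] [mg [M' gM]]; split; first exact: measurable_funD.
by exists (M + M') => x; rewrite (le_trans (ler_normD _ _))// lerD.
Qed.

Lemma bounded_mfun_cst c : bounded_mfun (fun=> c).
Proof. by split=> //; exists `|c|. Qed.

Lemma bounded_mfun_indic A : measurable A -> bounded_mfun (\1_A).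
Proof.
move=> mA; split; first exact: measurable_indic.
by exists 1 => x; rewrite indicE; case: (_ \in _); rewrite /= ?normr1 ?normr0.
Qed.

Lemma bounded_mfun_RintegralD f g : bounded_mfun f -> bounded_mfun g ->
  \int[P]_x (f x + g x) = \int[P]_x f x + \int[P]_x g x.
Proof. by move=> /bounded_mfun_integrable ? /bounded_mfun_integrable ?; rewrite RintegralD. Qed.

Lemma bounded_mfun_RintegralZl c f : bounded_mfun f -> \int[P]_x (c * f x) = c * \int[P]_x f x.
Proof. by move=> /bounded_mfun_integrable ?; rewrite RintegralZl. Qed.

Lemma Rintegral_indic A : measurable A -> \int[P]_x (\1_A x : R) = fine (P A).
Proof. by move=> mA; rewrite /Rintegral integral_indic// setIT. Qed.

Lemma Rintegral_probability_cst (c : R) : \int[P]_x c = c.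
Proof.
by rewrite (Rintegral_cst P measurableT) [X in fine X](_ : _ = 1%E) ?mulr1//; exact: probability_setT.
Qed.

(** Adding the constants [M] and 1 makes both factors non-negative, where [ge0_integral_mul_comp]
    applies; expanding the product, the added terms cancel. *)
Lemma indep_integral_mul (G : T -> R) (u : T' -> R) :
  bounded_mfun G -> measurable_fun setT u -> (forall y, `|u y| <= 1) ->
  (forall A, measurable A ->
    \int[P]_x (G x * \1_(Y @^-1` A) x) = (\int[P]_x G x) * fine (P (Y @^-1` A))) ->
  \int[P]_x (G x * u (Y x)) = (\int[P]_x G x) * \int[P]_x (u (Y x)).
Proof.
move=> bG mu u1 H.
have [mG [M GM]] := bG.
have buY : bounded_mfun (fun x => u (Y x)).
  by split; [exact: measurableT_comp|exists 1 => x; exact: u1].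
have bG' := bounded_mfunD bG (bounded_mfun_cst M).
have bu' := bounded_mfunD buY (bounded_mfun_cst 1).
have ge0 (v K : R) : `|v| <= K -> 0 <= v + K by rewrite ler_norml -lerBlDr sub0r => /andP[].
have cE : \int[P]_x (G x + M) = \int[P]_x G x + M.
  by rewrite bounded_mfun_RintegralD ?Rintegral_probability_cst//; exact: bounded_mfun_cst.
have uE : \int[P]_x (u (Y x) + 1) = \int[P]_x u (Y x) + 1.
  by rewrite bounded_mfun_RintegralD ?Rintegral_probability_cst//; exact: bounded_mfun_cst.
have c0 : 0 <= \int[P]_x G x + M by rewrite -cE; apply: Rintegral_ge0 => x _; exact: ge0.
have := @ge0_integral_mul_comp (fun x => G x + M) (\int[P]_x G x + M) (fun y => u y + 1).
rewrite (bounded_mfun_integral (bounded_mfunM bG' bu')) (bounded_mfun_integral bu') uE.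
have -> : \int[P]_x ((G x + M) * (u (Y x) + 1)) =
    \int[P]_x (G x * u (Y x)) + \int[P]_x G x + M * (\int[P]_x u (Y x) + 1).
  rewrite -uE -bounded_mfun_RintegralZl// -bounded_mfun_RintegralD//; last exact: bounded_mfunM.
  rewrite -bounded_mfun_RintegralD; last 2 first.
  - by apply: bounded_mfunD => //; exact: bounded_mfunM.
  - by apply: bounded_mfunM => //; exact: bounded_mfun_cst.
  by apply: eq_Rintegral => x _; ring.
move=> K; suff : (\int[P]_x (G x * u (Y x)) + \int[P]_x G x + M * (\int[P]_x u (Y x) + 1))%:E =
  ((\int[P]_x G x + M) * (\int[P]_x u (Y x) + 1))%:E by move=> []; lra.
apply: K => //.
- exact: measurable_funD.
- by move=> x; exact: ge0.
- move=> A mA.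
  have mYA : measurable (Y @^-1` A) by rewrite -[X in measurable X]setTI; exact: mY.
  have b1 := bounded_mfun_indic mYA.
  rewrite integral_mkcond.
  transitivity (\int[P]_x ((G x * \1_(Y @^-1` A) x) + M * \1_(Y @^-1` A) x)%:E)%E.
    apply: eq_integral => x _; rewrite patchE indicE; case: ifP => _ /=.
      by rewrite !mulr1.
    by rewrite !mulr0 addr0.
  have bM1 := bounded_mfunM (bounded_mfun_cst M) b1.
  rewrite (bounded_mfun_integral (bounded_mfunD (bounded_mfunM bG b1) bM1)) bounded_mfun_RintegralD//; last exact: bounded_mfunM.
  rewrite bounded_mfun_RintegralZl// H// Rintegral_indic// -mulrDl EFinM fineK//.
  exact: fin_num_measure.
- exact: measurable_funD.
- by move=> y; exact: ge0.
Qed.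

End independence.

Lemma eq_mean (dT : measure_display) (T : measurableType dT) (R : realType) (P : probability T R)
  (g f : T -> R) : f =1 g -> \int[P]_x f x = \int[P]_x g x.
Proof. by move=> /funext ->. Qed.
Arguments eq_mean {dT T R P} g {f} _.

(** * Means of the cosine and sine of a linear form in independent variables *)

Section independent_phases.
Context (dT : measure_display) (T : measurableType dT) (R : realType) (P : probability T R).
Context (I : finType) (D : {set I}) (X : I -> {RV P >-> R}) (b : I -> R).
Hypothesis indX : mutually_independent D X.
Implicit Types (K : {set I}) (A : I -> set R) (i : I) (s : seq I).

Definition phase (s : seq I) (w : T) : R := \sum_(i <- s) b i * X i w.

Definition cylinder (K : {set I}) (A : I -> set R) : set T :=
  \bigcap_(i in [set` K]) (X i @^-1` A i).

Lemma measurable_phase s : measurable_fun setT (phase s).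
Proof.
by apply: measurable_sum => i; apply: measurable_funM => //; exact: measurable_funPT.
Qed.

Lemma bounded_mfun_cos_comp (f : T -> R) : measurable_fun setT f -> bounded_mfun (fun w => cos (f w)).
Proof.
move=> mf; split; last by exists 1 => w; rewrite ler_norml cos_geN1 cos_le1.
have mc : measurable_fun setT (@cos R) by apply: continuous_measurable_fun; exact: continuous_cos.
exact: (measurableT_comp mc).
Qed.

Lemma bounded_mfun_sin_comp (f : T -> R) : measurable_fun setT f -> bounded_mfun (fun w => sin (f w)).
Proof.
move=> mf; split; last by exists 1 => w; rewrite ler_norml sin_geN1 sin_le1.
have ms : measurable_fun setT (@sin R) by apply: continuous_measurable_fun; exact: continuous_sin.
exact: (measurableT_comp ms).
Qed.

Lemma measurable_cylinder K A : (forall i, measurable (A i)) -> measurable (cylinder K A).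
Proof.
move=> mA; apply: fin_bigcap_measurable => [|i _]; first exact: finite_finset.
by rewrite -[X in measurable X]setTI; exact: measurable_funPT.
Qed.

Lemma cylinder_setU1 K A i (A0 : set R) : i \notin K ->
  cylinder K A `&` (X i @^-1` A0) =
  cylinder (i |: K) (fun j => if j == i then A0 else A j).
Proof.
move=> iK; apply/seteqP; split=> w.
  move=> [HK Hi] j /=; rewrite in_setU1 => /orP[/eqP ->|jK]; first by rewrite eqxx.
  case: eqP => [ji|_]; first by rewrite ji in jK; rewrite jK in iK.
  exact: HK.
move=> H; split; last by have := H i; rewrite /= setU11 eqxx; apply.
move=> j /= jK; have := H j; rewrite /= in_setU1 jK orbT => /(_ isT).
by case: eqP => // ji; rewrite ji in jK; rewrite jK in iK.
Qed.

Lemma prob_cylinder_setU1 K A i (A0 : set R) : i \notin K -> i \in D -> K \subset D ->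
  (forall j, measurable (A j)) -> measurable A0 ->
  P (cylinder K A `&` (X i @^-1` A0)) = (P (cylinder K A) * P (X i @^-1` A0))%E.
Proof.
move=> iK iD KD mA mA0; rewrite cylinder_setU1// /cylinder !indX//; last 2 first.
- by rewrite finset.subUset finset.sub1set iD.
- by move=> j; case: ifP.
rewrite big_setU1//= eqxx muleC; congr (_ * _)%E.
by apply: eq_bigr => j jK; case: eqP => // ji; rewrite ji in jK; rewrite jK in iK.
Qed.

(** Independence of [f] from the variables with index in [D] and outside [s], tested on finite
    cylinders only. It is the invariant of the induction on [s] and avoids generated
    sigma-algebras. *)
Definition decoupled (s : seq I) (f : T -> R) := forall K A,
  K \subset D -> (forall j, j \in s -> j \notin K) -> (forall j, measurable (A j)) ->
  \int[P]_w (f w * \1_(cylinder K A) w) = (\int[P]_w f w) * fine (P (cylinder K A)).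

Lemma cylinder0 A : cylinder finset.set0 A = setT.
Proof. by apply/seteqP; split=> w // _ j /=; rewrite inE. Qed.

(** Intersecting the cylinder with an event on [X i] gives another cylinder whose indices avoid [s];
    so [f] times the indicator of the cylinder is itself independent of [X i]. *)
Lemma decoupled_int_mul i s (f : T -> R) (u : R -> R) K A : i \in D -> i \notin s -> bounded_mfun f ->
  measurable_fun setT u -> (forall y, `|u y| <= 1) -> decoupled s f ->
  K \subset D -> (forall j, j \in i :: s -> j \notin K) -> (forall j, measurable (A j)) ->
  \int[P]_w (f w * u (X i w) * \1_(cylinder K A) w) =
  (\int[P]_w f w) * (\int[P]_w u (X i w)) * fine (P (cylinder K A)).
Proof.
move=> iD si bf mu u1 df KD sK mA.
have mC := measurable_cylinder K mA.
have bG := bounded_mfunM bf (bounded_mfun_indic R mC).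
have mX : measurable_fun setT (X i) by exact: measurable_funPT.
have iK : i \notin K by rewrite sK ?mem_head.
have sK' j : j \in s -> j \notin K by move=> js; rewrite sK// inE js orbT.
have := @indep_integral_mul _ _ _ P _ _ (X i) mX _ u bG mu u1.
rewrite df// => H; rewrite mulrAC -H; last first.
  move=> A0 mA0.
  rewrite (eq_mean (fun w => f w * \1_(cylinder K A `&` (X i @^-1` A0)) w)); last first.
    by move=> w; rewrite indicI -mulrA.
  rewrite cylinder_setU1// df//.
  - have mXA : measurable (X i @^-1` A0) by rewrite -[X in measurable X]setTI; exact: mX.
    rewrite -cylinder_setU1// prob_cylinder_setU1// fineM ?mulrA//.
      exact: fin_num_measure.
    exact: fin_num_measure.
  - by rewrite finset.subUset finset.sub1set iD.
  - by move=> j js; rewrite in_setU1 negb_or sK'// andbT; apply: contraNneq si => <-.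
  - by move=> j; case: ifP.
by apply: eq_Rintegral => w _; rewrite mulrAC.
Qed.

Local Notation mcos i := (\int[P]_w cos (b i * X i w)).
Local Notation msin i := (\int[P]_w sin (b i * X i w)).
Local Notation pcos s := (\int[P]_w cos (phase s w)).
Local Notation psin s := (\int[P]_w sin (phase s w)).

Lemma decoupled_cons i s K A : i \in D -> i \notin s ->
  decoupled s (fun w => cos (phase s w)) -> decoupled s (fun w => sin (phase s w)) ->
  K \subset D -> (forall j, j \in i :: s -> j \notin K) -> (forall j, measurable (A j)) ->
  \int[P]_w (cos (phase (i :: s) w) * \1_(cylinder K A) w) =
    (pcos s * mcos i - psin s * msin i) * fine (P (cylinder K A)) /\
  \int[P]_w (sin (phase (i :: s) w) * \1_(cylinder K A) w) =
    (psin s * mcos i + pcos s * msin i) * fine (P (cylinder K A)).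
Proof.
move=> iD si dc ds KD sK mA.
have bc := bounded_mfun_cos_comp (measurable_phase s).
have bs := bounded_mfun_sin_comp (measurable_phase s).
have mlin : measurable_fun setT (fun y : R => b i * y) by exact: measurable_funM.
have mcb : measurable_fun setT (fun y : R => cos (b i * y)).
  apply: (measurableT_comp (f := cos)) => //.
  by apply: continuous_measurable_fun; exact: continuous_cos.
have msb : measurable_fun setT (fun y : R => sin (b i * y)).
  apply: (measurableT_comp (f := sin)) => //.
  by apply: continuous_measurable_fun; exact: continuous_sin.
have c1 (y : R) : `|cos (b i * y)| <= 1 by rewrite ler_norml cos_geN1 cos_le1.
have s1 (y : R) : `|sin (b i * y)| <= 1 by rewrite ler_norml sin_geN1 sin_le1.
have bC : bounded_mfun (\1_(cylinder K A) : T -> R) by apply: bounded_mfun_indic;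
  exact: measurable_cylinder.
have bcX : bounded_mfun (fun w => cos (b i * X i w)).
  by apply: bounded_mfun_cos_comp; apply: measurable_funM => //; exact: measurable_funPT.
have bsX : bounded_mfun (fun w => sin (b i * X i w)).
  by apply: bounded_mfun_sin_comp; apply: measurable_funM => //; exact: measurable_funPT.
have b1 := bounded_mfunM (bounded_mfunM bc bcX) bC; have b2 := bounded_mfunM (bounded_mfunM bs bsX) bC.
have b3 := bounded_mfunM (bounded_mfunM bs bcX) bC; have b4 := bounded_mfunM (bounded_mfunM bc bsX) bC.
have e1 := decoupled_int_mul iD si bc mcb c1 dc KD sK mA.
have e2 := decoupled_int_mul iD si bs msb s1 ds KD sK mA.
have e3 := decoupled_int_mul iD si bs mcb c1 ds KD sK mA.
have e4 := decoupled_int_mul iD si bc msb s1 dc KD sK mA.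
split.
  rewrite mulrBl -e1 -e2 -[X in _ + X]mulN1r -(bounded_mfun_RintegralZl P)// -bounded_mfun_RintegralD//; last first.
    by apply: bounded_mfunM => //; exact: bounded_mfun_cst.
  apply: eq_Rintegral => w _; rewrite /phase big_cons addrC cosD -/(phase s w).
  by ring.
rewrite mulrDl -e3 -e4 -bounded_mfun_RintegralD//.
apply: eq_Rintegral => w _; rewrite /phase big_cons addrC sinD -/(phase s w).
by ring.
Qed.

Lemma mean_phase_cons i s : i \in D -> i \notin s ->
  decoupled s (fun w => cos (phase s w)) -> decoupled s (fun w => sin (phase s w)) ->
  pcos (i :: s) = pcos s * mcos i - psin s * msin i /\
  psin (i :: s) = psin s * mcos i + pcos s * msin i.
Proof.
move=> iD si dc ds.
have := @decoupled_cons i s finset.set0 (fun=> setT) iD si dc ds (finset.sub0set _)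
  (fun j _ => negbT (finset.in_set0 j)) (fun=> measurableT).
rewrite cylinder0 [fine _](_ : _ = 1) ?mulr1; last by rewrite probability_setT.
have one (f : T -> R) : \int[P]_w (f w * \1_setT w) = \int[P]_w f w.
  by apply: eq_mean => w; rewrite indicT mulr1.
by rewrite !one.
Qed.

Lemma decoupled_phase s : uniq s -> {subset s <= D} ->
  decoupled s (fun w => cos (phase s w)) /\ decoupled s (fun w => sin (phase s w)).
Proof.
elim: s => [|i s IHs] /=.
  move=> _ _; split=> K A KD _ mA; have mC := measurable_cylinder K mA.
    rewrite (eq_mean (\1_(cylinder K A))); last first.
      by move=> w; rewrite /phase big_nil cos0 mul1r.
    rewrite Rintegral_indic// (eq_mean (fun=> 1)) ?Rintegral_probability_cst ?mul1r//.
    by move=> w; rewrite /phase big_nil cos0.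
  rewrite (eq_mean (fun=> 0)); last first.
    by move=> w; rewrite /phase big_nil sin0 mul0r.
  rewrite Rintegral_probability_cst (eq_mean (fun=> 0)) ?Rintegral_probability_cst ?mul0r//.
  by move=> w; rewrite /phase big_nil sin0.
move=> /andP[si us] sD.
have iD : i \in D by rewrite sD ?mem_head.
have [dc ds] := IHs us (fun j js => sD j (mem_behead (s := i :: s) js)).
have [fc fs] := mean_phase_cons iD si dc ds.
by split=> K A KD sK mA; have [ec es] := decoupled_cons iD si dc ds KD sK mA; rewrite ?ec ?es ?fc ?fs.
Qed.

(** In complex terms the mean of [exp (i * phase)] is the product of the means of its factors, and
    one vanishing factor is enough. *)
Lemma mean_phase0 s i : uniq s -> {subset s <= D} -> i \in s ->
  mcos i = 0 -> msin i = 0 -> pcos s = 0 /\ psin s = 0.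
Proof.
elim: s => // j s IHs /= /andP[js us] sD; rewrite inE => ij ci si.
have jD : j \in D by rewrite sD ?mem_head.
have sD' k : k \in s -> k \in D by move=> ks; rewrite sD// inE ks orbT.
have [dc ds] := decoupled_phase us sD'.
have [-> ->] := mean_phase_cons jD js dc ds.
move: ij => /orP[/eqP <-|/IHs]; first by rewrite ci si !mulr0 subrr addr0.
by move=> /(_ us sD' ci si) [-> ->]; rewrite !mul0r subrr addr0.
Qed.

End independent_phases.

(** * Mean squared exponential sums *)

Section mean_square.
Context (dT : measure_display) (T : measurableType dT) (R : realType) (P : probability T R).

Lemma ge0_integral_law d' (T' : measurableType d') (Y : T -> T') (m2 : {measure set T' -> \bar R})
    (f : T' -> \bar R) : measurable_fun setT Y -> measurable_fun setT f ->
    (forall y, 0 <= f y)%E -> (forall A, measurable A -> P (Y @^-1` A) = m2 A) ->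
  (\int[P]_w f (Y w) = \int[m2]_y f y)%E.
Proof.
move=> mY mf f0 H.
pose Ymix := isMeasurableFun.Build _ _ _ _ _ mY.
pose Yf : {mfun T >-> T'} := HB.pack Y Ymix.
rewrite (eq_measure_integral (pushforward P Yf)); last by move=> A mA _; rewrite -H.
by rewrite ge0_integral_pushforward.
Qed.

Lemma uniform_mean_cos (X : {RV P >-> R}) (k : int) (c : R) : uniform01 X -> k != 0 ->
  \int[P]_w cos (2 * pi * (k%:~R * X w) + c) = 0.
Proof.
move=> uX k0; pose u (y : R) := cos (2 * pi * (k%:~R * y) + c).
have cu : continuous u.
  by move=> x; rewrite /u; under eq_fun do rewrite mulrA; exact: continuous_cos_lin.
have mu : measurable_fun setT u by exact: continuous_measurable_fun.
have mu1 : measurable_fun setT (fun y => (1 + u y)%:E).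
  by apply/measurable_EFinP; exact: measurable_funD.
have u0 y : (0 <= (1 + u y)%:E)%E.
  by rewrite lee_fin -lerBlDl sub0r cos_geN1.
have bu : bounded_mfun (fun w => u (X w)).
  apply: bounded_mfun_cos_comp; apply: measurable_funD => //; apply: measurable_funM => //.
  by apply: measurable_funM => //; exact: measurable_funPT.
(* The change of variables is available for non-negative functions, hence the added 1. *)
suff : (\int[P]_w (1 + u (X w))%:E = 1)%E.
  rewrite (bounded_mfun_integral P (bounded_mfunD (bounded_mfun_cst T 1) bu)) bounded_mfun_RintegralD ?Rintegral_probability_cst//; last exact: bounded_mfun_cst.
  by move=> [] /eqP; rewrite -subr_eq0 addrAC subrr add0r => /eqP.
have mX : measurable_fun setT (X : T -> measurableTypeR R) by exact: (measurable_funPT X).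
rewrite (ge0_integral_law (m2 := uniform_prob (@ltr01 R)) mX mu1 u0 (uX : forall A, _)).
rewrite integral_uniform// subr0 invr1 mul1e.
rewrite -integral_itv_bndo_bndc; last exact: measurable_funTS.
have i1 : (@lebesgue_measure R).-integrable `[0%R, 1%R[ (EFin \o (fun=> 1 : R)).
  apply: measurable_bounded_integrable => //.
  - by rewrite [X in (X < _)%E](_ : _ = 1%E) ?ltry//; exact: leb01.
  - exists 1; split; first by rewrite num_real.
    by move=> x x1 y _ /=; rewrite normr1 ltW.
have iu : (@lebesgue_measure R).-integrable `[0%R, 1%R[ (EFin \o u).
  apply: measurable_bounded_integrable => //.
  - by rewrite [X in (X < _)%E](_ : _ = 1%E) ?ltry//; exact: leb01.
  - exact: measurable_funTS.
  - exists 1; split; first by rewrite num_real.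
    by move=> x x1 y _ /=; rewrite (le_trans _ (ltW x1))// ler_norml cos_geN1 cos_le1.
transitivity (\int[lebesgue_measure]_(x in `[0%R, 1%R[) ((EFin \o (fun=> 1%R : R)) x + (EFin \o u) x))%E.
  by apply: eq_integral => x _; rewrite /= EFinD.
rewrite integralD//= integral_cos_itv (negbTE k0) adde0 integral_cst// mul1e.
exact: leb01.
Qed.

Lemma sum_sqr_cos_sin N (u : 'I_N -> R) :
  (\sum_(n < N) cos (u n)) ^+ 2 + (\sum_(n < N) sin (u n)) ^+ 2 =
  \sum_(n < N) \sum_(m < N) cos (u n - u m).
Proof.
rewrite !expr2 !mulr_suml -big_split /=; apply: eq_bigr => n _.
by rewrite !mulr_sumr -big_split /=; apply: eq_bigr => m _; rewrite cosB.
Qed.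

Lemma expsum_sqrE N s (Q : 'I_N -> s.-tuple R) h : expsum_sqr Q h =
  N%:R ^- 2 * \sum_(n < N) \sum_(m < N) cos (2 * pi * dot h (Q n) - 2 * pi * dot h (Q m)).
Proof. by rewrite -sum_sqr_cos_sin /expsum_sqr /mean_cos /mean_sin !exprMn -mulrDr exprVn. Qed.

Context (N s d : nat) (z : 'I_d -> nat) (X : 'I_N * 'I_s -> {RV P >-> R}).
Hypothesis N0 : (0 < N)%N.
Hypothesis uX : forall i : 'I_N * 'I_s, (d <= i.2)%N -> uniform01 (X i).
Let D := [set i : 'I_N * 'I_s | (d <= i.2)%N]%SET.
Hypothesis indX : mutually_independent D X.

Let Q (w : T) : 'I_N -> s.-tuple R :=
  concatenated_points z (fun (n : 'I_N) (j : 'I_s) => X (n, j) w).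

Definition lattice_part (h : s.-tuple int) (n : 'I_N) : R :=
  \sum_(j < s | (j < d)%N)
    (tnth h j)%:~R * (if insub (val j) is Some i then tnth (lattice_points z n) i else 0).

Lemma dot_concatenated (h : s.-tuple int) n w : dot h (Q w n) =
  lattice_part h n + \sum_(j < s | (d <= j)%N) (tnth h j)%:~R * X (n, j) w.
Proof.
rewrite /dot (bigID (fun j : 'I_s => (j < d)%N)) /=; congr (_ + _).
  apply: eq_bigr => j jd; rewrite tnth_mktuple.
  by case: insubP => //= /negP.
apply: eq_big => [j|j]; first by rewrite -leqNgt.
rewrite -leqNgt => dj; rewrite tnth_mktuple; case: insubP => //= i ij.
by rewrite ltnNge dj in ij.
Qed.

(** For [i] in [D], the coefficient of [X i] in [2 * pi * (dot h (Q w n) - dot h (Q w m))]. *)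
Definition phase_coef (h : s.-tuple int) (n m : 'I_N) (i : 'I_N * 'I_s) : R :=
  2 * pi * ((tnth h i.2)%:~R * ((i.1 == n)%:R - (i.1 == m)%:R)).

Lemma dot_sub_phase (h : s.-tuple int) n m w :
  2 * pi * dot h (Q w n) - 2 * pi * dot h (Q w m) =
  2 * pi * (lattice_part h n - lattice_part h m) + phase X (phase_coef h n m) (enum D) w.
Proof.
have pick (n0 : 'I_N) : \sum_(i in D) (tnth h i.2)%:~R * (i.1 == n0)%:R * X i w =
    \sum_(j < s | (d <= j)%N) (tnth h j)%:~R * X (n0, j) w.
  transitivity (\sum_(p : 'I_N) \sum_(j < s | (d <= j)%N)
      (tnth h j)%:~R * (p == n0)%:R * X (p, j) w).
    rewrite pair_big_dep /=; apply: eq_big => [[p j]|[p j] _] //=.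
    by rewrite inE.
  rewrite (bigD1 n0)//= [X in _ + X]big1 ?addr0.
    by apply: eq_bigr => j _; rewrite eqxx mulr1.
  by move=> p /negbTE pn; apply: big1 => j _; rewrite pn mulr0 mul0r.
rewrite /phase big_enum /= (eq_bigr (fun i => 2 * pi *
   ((tnth h i.2)%:~R * (i.1 == n)%:R * X i w - (tnth h i.2)%:~R * (i.1 == m)%:R * X i w))); last first.
  by move=> i _; rewrite /phase_coef; ring.
by rewrite -mulr_sumr sumrB !pick !dot_concatenated; ring.
Qed.

(** For distinct points the variable [X (n, j)] enters the phase with the factor
    [2 * pi * tnth h j], a non-zero integer multiple of [2 * pi], and its uniform law makes the mean
    vanish. *)
Lemma mean_cos_dot_sub (h : s.-tuple int) n m (j : 'I_s) : (d <= j)%N -> tnth h j != 0 ->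
  \int[P]_w cos (2 * pi * dot h (Q w n) - 2 * pi * dot h (Q w m)) = (n == m)%:R.
Proof.
move=> dj hj; have [->|nm] := eqVneq n m.
  rewrite (eq_mean (fun=> 1)) ?Rintegral_probability_cst// => w.
  by rewrite subrr cos0.
(* The free phase [c] covers the cosine ([c = 0]) and the sine ([c = - (pi / 2)]). *)
have mz (c : R) : \int[P]_w cos (phase_coef h n m (n, j) * X (n, j) w + c) = 0.
  rewrite (eq_mean (fun w => cos (2 * pi * ((tnth h j)%:~R * X (n, j) w) + c))); last first.
    by move=> w; rewrite /phase_coef /= eqxx (negbTE nm) subr0 mulr1 mulrA.
  by apply: uniform_mean_cos => //; exact: uX.
have [pc ps] : \int[P]_w cos (phase X (phase_coef h n m) (enum D) w) = 0 /\
    \int[P]_w sin (phase X (phase_coef h n m) (enum D) w) = 0.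
  apply: (mean_phase0 (b := phase_coef h n m) (i := (n, j)) indX).
  - exact: enum_uniq.
  - by move=> i; rewrite mem_enum.
  - by rewrite mem_enum inE.
  - by rewrite -[RHS](mz 0); apply: eq_mean => w; rewrite addr0.
  - by rewrite -[RHS](mz (- (pi / 2))); apply: eq_mean => w; rewrite cosBpihalf.
set a := 2 * pi * (lattice_part h n - lattice_part h m).
have bc := bounded_mfun_cos_comp (measurable_phase X (phase_coef h n m) (enum D)).
have bs := bounded_mfun_sin_comp (measurable_phase X (phase_coef h n m) (enum D)).
rewrite (eq_mean (fun w => cos a * cos (phase X (phase_coef h n m) (enum D) w) +
   - sin a * sin (phase X (phase_coef h n m) (enum D) w))); last first.
  by move=> w; rewrite dot_sub_phase cosD mulNr.
rewrite bounded_mfun_RintegralD; last 2 first.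
- by apply: bounded_mfunM => //; exact: bounded_mfun_cst.
- by apply: bounded_mfunM => //; exact: bounded_mfun_cst.
by rewrite !bounded_mfun_RintegralZl// pc ps !mulr0 addr0.
Qed.

Lemma bounded_mfun_cos_dot (h : s.-tuple int) n m :
  bounded_mfun (fun w => cos (2 * pi * dot h (Q w n) - 2 * pi * dot h (Q w m))).
Proof.
apply: bounded_mfun_cos_comp.
rewrite (_ : (fun w => _) = (fun w => 2 * pi * (lattice_part h n - lattice_part h m) +
   phase X (phase_coef h n m) (enum D) w)); last first.
  by apply/funext => w; exact: dot_sub_phase.
by apply: measurable_funD => //; exact: measurable_phase.
Qed.

Lemma bounded_mfun_sum (I : Type) (r : seq I) (f : I -> T -> R) : (forall i, bounded_mfun (f i)) ->
  bounded_mfun (fun w => \sum_(i <- r) f i w).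
Proof.
move=> bf; elim: r => [|i r IHr].
  by rewrite (_ : (fun _ => _) = fun=> 0); [exact: bounded_mfun_cst|apply/funext => w; rewrite big_nil].
rewrite (_ : (fun _ => _) = fun w => f i w + \sum_(j <- r) f j w); first exact: bounded_mfunD.
by apply/funext => w; rewrite big_cons.
Qed.

Lemma bounded_mfun_Rintegral_sum (I : Type) (r : seq I) (f : I -> T -> R) : (forall i, bounded_mfun (f i)) ->
  \int[P]_w (\sum_(i <- r) f i w) = \sum_(i <- r) \int[P]_w f i w.
Proof.
move=> bf; elim: r => [|i r IHr].
  by rewrite big_nil (eq_mean (fun=> 0)) ?Rintegral_probability_cst// => w; rewrite big_nil.
rewrite big_cons -IHr -bounded_mfun_RintegralD//; last exact: bounded_mfun_sum.
by apply: eq_mean => w; rewrite big_cons.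
Qed.

Lemma bounded_mfun_expsum_sqr (h : s.-tuple int) : bounded_mfun (fun w => expsum_sqr (Q w) h).
Proof.
rewrite (_ : (fun w => _) = (fun w => N%:R ^- 2 * \sum_(n < N) \sum_(m < N)
   cos (2 * pi * dot h (Q w n) - 2 * pi * dot h (Q w m)))); last first.
  by apply/funext => w; exact: expsum_sqrE.
apply: bounded_mfunM; first exact: bounded_mfun_cst.
by do 2! apply: bounded_mfun_sum => ?; exact: bounded_mfun_cos_dot.
Qed.

(** Only the [N] diagonal terms of the double sum survive, under the factor [1 / N ^ 2]. *)
Lemma mean_expsum_sqr (h : s.-tuple int) (j : 'I_s) : (d <= j)%N -> tnth h j != 0 ->
  \int[P]_w expsum_sqr (Q w) h = N%:R^-1.
Proof.
move=> dj hj; rewrite (eq_mean (fun w => N%:R ^- 2 * \sum_(n < N) \sum_(m < N)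
   cos (2 * pi * dot h (Q w n) - 2 * pi * dot h (Q w m)))); last by move=> w; exact: expsum_sqrE.
rewrite bounded_mfun_RintegralZl; last by do 2! apply: bounded_mfun_sum => ?;
  exact: bounded_mfun_cos_dot.
rewrite bounded_mfun_Rintegral_sum; last by move=> n; apply: bounded_mfun_sum => m;
  exact: bounded_mfun_cos_dot.
rewrite (eq_bigr (fun=> 1)); last first.
  move=> n _; rewrite bounded_mfun_Rintegral_sum; last by move=> m; exact: bounded_mfun_cos_dot.
  rewrite (eq_bigr (fun m => (n == m)%:R)); last by move=> m _; exact: mean_cos_dot_sub dj hj.
  by rewrite (bigD1 n)//= eqxx big1 ?addr0// => m; rewrite eq_sym => /negbTE ->.
rewrite sumr_const card_ord -[X in _ * X]mulr_natl mulr1 expr2 invfM -mulrA mulVf ?mulr1//.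
by rewrite pnatr_eq0 -lt0n.
Qed.

End mean_square.

(** * Exchange of integrals and unordered sums *)

Section esum_integral.
Context (dT : measure_display) (T : measurableType dT) (R : realType) (mu : {measure set T -> \bar R}).
Local Open Scope ereal_scope.

(* The worst-case error is not known to be measurable in the random points;
   being a supremum over simple minorants, the integral is monotone anyway. *)
Lemma le_integral_nonmeasurable (f g : T -> \bar R) :
  (forall x, 0 <= f x) -> (forall x, f x <= g x) -> \int[mu]_x f x <= \int[mu]_x g x.
Proof.
move=> f0 fg; have g0 x : 0 <= g x by rewrite (le_trans (f0 x)).
rewrite !ge0_integralTE//; apply: le_ereal_sup => _ [h hf <-].
by exists h => // x; rewrite (le_trans (hf x)).
Qed.

(** Enumeration of a countable index type, with 0 at the codes that decode to nothing, makes the sum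
    a series to which Tonelli's theorem applies. *)
Lemma esum_pickle (I : countType) (F : I -> \bar R) : (forall i, 0 <= F i) ->
  \esum_(i in [set: I]) F i = \sum_(n <oo) oapp F 0 (pickle_inv n).
Proof.
move=> F0; rewrite nneseries_esumT; last by move=> n; case: pickle_inv => /=.
rewrite (esumID (range (@choice.pickle I))); last by move=> n _; case: pickle_inv => /=.
rewrite setTI [X in _ + X]esum1 ?adde0; last first.
  move=> n [_ nr]; have := @choice.pickle_invK I n; case: pickle_inv => //= i ei.
  by exfalso; apply: nr; exists i.
rewrite esum_image; last by move=> i j _ _ /(pcan_inj choice.pickleK).
by apply: eq_esum => i _; rewrite pickleK_inv.
Qed.

Lemma integral_esum (I : countType) (F : I -> T -> \bar R) : (forall i x, 0 <= F i x) ->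
  (forall i, measurable_fun setT (F i)) ->
  \int[mu]_x (\esum_(i in [set: I]) F i x) = \esum_(i in [set: I]) (\int[mu]_x F i x).
Proof.
move=> F0 mF; under eq_integral do rewrite esum_pickle//.
rewrite esum_pickle; last by move=> i; exact: integral_ge0.
rewrite integral_nneseries//; last 2 first.
- by move=> n; case: pickle_inv => [i|] //=.
- by move=> n x _; case: pickle_inv => /=.
by apply: eq_eseriesr => n _; case: pickle_inv => //=; rewrite integral0.
Qed.

End esum_integral.

(** * Summation of the mean squared exponential sums over all frequencies *)

Section mean_exp_sum.
Variables (R : realType) (N d : nat) (z : nat -> nat).

Definition tail0 s (h : s.-tuple int) := [forall j : 'I_s, (d <= j)%N ==> (tnth h j == 0)].

(** The mean of [expsum_sqr] at [h] over the random points ([mean_expsum_sqr_weight]), in a form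
    free of random variables. *)
Definition mean_weight s (h : s.-tuple int) : R :=
  if tail0 h then (if (N %| int_dot z h)%Z then 1 else 0) else N%:R^-1.

Lemma mean_weight_ge0 s (h : s.-tuple int) : 0 <= mean_weight h.
Proof. by rewrite /mean_weight; case: ifP => _; [case: ifP|rewrite invr_ge0]. Qed.

Lemma mean_weight_base (h : d.-tuple int) : mean_weight h = if (N %| int_dot z h)%Z then 1 else 0.
Proof.
rewrite /mean_weight (_ : tail0 h)//; apply/forallP => j.
by rewrite leqNgt ltn_ord.
Qed.

Lemma mean_weight_rtuple0 s (h : s.-tuple int) : mean_weight (rtuple h 0) = mean_weight h.
Proof.
rewrite /mean_weight int_dot_rtuple mul0r addr0 (_ : tail0 (rtuple h 0) = tail0 h)//.
apply/forallP/forallP => H j.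
  by have := H (widen_ord (leqnSn s) j); rewrite tnth_rtuple_widen.
case: (unliftP ord_max j) => [i ->|->]; last by rewrite tnth_rtuple_max eqxx implybT.
have -> : lift ord_max i = widen_ord (leqnSn s) i.
  by apply: val_inj; rewrite /= /bump leqNgt ltn_ord.
by rewrite tnth_rtuple_widen; exact: H.
Qed.

Lemma mean_weight_rtuple s (h : s.-tuple int) k : (d <= s)%N -> k != 0 ->
  mean_weight (rtuple h k) = N%:R^-1.
Proof.
move=> ds k0; rewrite /mean_weight ifN//; apply/negP => /forallP /(_ ord_max).
by rewrite tnth_rtuple_max ds /= (negbTE k0).
Qed.

Lemma mean_weight_zero s : mean_weight (zero_freq s) = 1.
Proof.
rewrite /mean_weight ifT; last by apply/forallP => j; rewrite tnth_mktuple eqxx implybT.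
by rewrite int_dot_zero dvdz0.
Qed.

Variables (a : R) (g : nat -> R).
Hypotheses (a1 : 1 < a) (g0 : forall j, 0 <= g j).

(** Induction on the number of random coordinates. A non-zero last entry has weight [1 / N], and the
    decays of these frequencies sum to [2 * g n * zeta a] times the product over the first [n]
    coordinates, which is the increment of that product. *)
Lemma esum_mean_weight s : (d <= s)%N ->
  (\esum_(h in [set: s.-tuple int]) (decays a g h * mean_weight h)%:E =
   dual_sum N a g d z + (N%:R^-1 *
     (\prod_(j < s) (1 + 2 * g j * zeta a) - \prod_(j < d) (1 + 2 * g j * zeta a)))%:E)%E.
Proof.
move=> /subnKC <-; elim: (s - d)%N => [|k IHk].
  rewrite addn0 subrr mulr0 adde0 /dual_sum [RHS]esum_mkcond; apply: eq_esum => h _.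
  by rewrite mean_weight_base /dual mem_set_bool; case: ifP; rewrite ?mulr1 ?mulr0.
rewrite addnS; move: IHk; set n := (d + k)%N => IHk.
have dn : (d <= n)%N by rewrite leq_addr.
rewrite esum_rtuple; last by move=> h; rewrite lee_fin mulr_ge0 ?decays_ge0 ?mean_weight_ge0.
have E (h : n.-tuple int) : \esum_(k in [set: int]) (decays a g (rtuple h k) * mean_weight (rtuple h k))%:E =
   ((decays a g h * mean_weight h)%:E + (2 * g n * zeta a / N%:R)%:E * (decays a g h)%:E)%E.
  rewrite (esumID [set 0]); last by move=> i _; rewrite lee_fin mulr_ge0 ?decays_ge0 ?mean_weight_ge0.
  rewrite setTI esum_set1 ?lee_fin ?mulr_ge0 ?decays_ge0 ?mean_weight_ge0//.
  congr (_ + _)%E; first by rewrite decays_rtuple /decay1 eqxx mulr1 mean_weight_rtuple0.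
  rewrite setTI (_ : ~` [set 0] = [set k : int | k != 0]); last by apply/seteqP; split=> i /= /eqP.
  rewrite (eq_esum (b := fun i => (decays a g h / N%:R)%:E * (decay1 a (g n) i)%:E)%E); last first.
    by move=> i i0; rewrite decays_rtuple mean_weight_rtuple// -EFinM; congr (_%:E); ring.
  rewrite esumZl ?esum_decay1_neq0//; last 2 first.
  - by rewrite divr_ge0 ?decays_ge0.
  - by move=> i; rewrite lee_fin decay1_ge0.
  by rewrite -!EFinM; congr (_%:E); ring.
under eq_esum do rewrite E.
have c0 : 0 <= 2 * g n * zeta a / N%:R by rewrite divr_ge0// mulr_ge0 ?zeta_ge0// mulr_ge0.
rewrite esumD; last 2 first.
- by move=> h _; rewrite lee_fin mulr_ge0 ?decays_ge0 ?mean_weight_ge0.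
- by move=> h _; rewrite -EFinM lee_fin mulr_ge0// decays_ge0.
rewrite IHk esumZl//; last by move=> h; rewrite lee_fin decays_ge0.
rewrite esum_decays// -addeA -EFinM -EFinD; congr (_ + _%:E)%E.
by rewrite [in RHS]big_ord_recr /=; ring.
Qed.

End mean_exp_sum.

(** * Mean squared worst-case error of the concatenated points *)

Section mean_wce.
Context (dT : measure_display) (T : measurableType dT) (R : realType) (P : probability T R).
Context (N s d : nat) (z : 'I_d -> nat) (X : 'I_N * 'I_s -> {RV P >-> R}).
Hypothesis N0 : (0 < N)%N.
Hypothesis ds : (d <= s)%N.
Hypothesis uX : forall i : 'I_N * 'I_s, (d <= i.2)%N -> uniform01 (X i).
Hypothesis indX : mutually_independent [set i : 'I_N * 'I_s | (d <= i.2)%N]%SET X.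

(** The default [0] from index [d] on lets the generating vector be read in dimension [s] as
    well. *)
Definition nat_vector (j : nat) : nat := if insub j is Some i then z i else 0%N.

Let Q (w : T) : 'I_N -> s.-tuple R :=
  concatenated_points z (fun (n : 'I_N) (j : 'I_s) => X (n, j) w).

Lemma dot_concatenated_tail0 (h : s.-tuple int) n w : tail0 d h ->
  dot h (Q w n) = dot h (lattice_points (fun j : 'I_s => nat_vector j) n).
Proof.
move=> /forallP h0; apply: eq_bigr => j _; rewrite !tnth_mktuple /nat_vector.
case: insubP => [i _ _|]; first by rewrite tnth_mktuple.
by rewrite -leqNgt => dj; have := h0 j; rewrite dj /= => /eqP ->; rewrite !mul0r.
Qed.

Lemma mean_expsum_sqr_weight (h : s.-tuple int) :
  \int[P]_w expsum_sqr (Q w) h = mean_weight R N d nat_vector h.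
Proof.
rewrite /mean_weight; case: ifPn => [h0|].
  rewrite (eq_mean (fun=> expsum_sqr (lattice_points (N := N) (fun j : 'I_s => nat_vector j)) h));
    last first.
    move=> w; rewrite /expsum_sqr /mean_cos /mean_sin; congr ((_ * _) ^+ 2 + (_ * _) ^+ 2);
    by apply: eq_bigr => n _; rewrite dot_concatenated_tail0.
  by rewrite Rintegral_probability_cst expsum_sqr_lattice.
rewrite negb_forall => /existsP[j]; rewrite negb_imply => /andP[dj hj].
exact: mean_expsum_sqr hj.
Qed.

Lemma mean_wce_le alpha gamma : 1 / 2 < alpha -> (forall j, 0 < gamma j) ->
  (\int[P]_w worst_case_error alpha gamma (Q w) ^+ 2 <=
   dual_sum N (2 * alpha) gamma d nat_vector - 1 +
     (N%:R^-1 * (\prod_(j < s) (1 + 2 * gamma j * zeta (2 * alpha)) -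
                 \prod_(j < d) (1 + 2 * gamma j * zeta (2 * alpha))))%:E)%E.
Proof.
move=> a2 g0; have a1 : 1 < 2 * alpha by rewrite mulrC -ltr_pdivrMr.
have g0' j : 0 <= gamma j by exact/ltW.
have expsum_sqr0 h w : 0 <= expsum_sqr (Q w) h by rewrite addr_ge0 ?sqr_ge0.
pose F (h : s.-tuple int) (w : T) : \bar R :=
  (* The zero frequency gets the value 0, so that the sum runs over the whole countable type and can
     be exchanged with the integral. *)
  if h == zero_freq s then 0%E else (decays (2 * alpha) gamma h * expsum_sqr (Q w) h)%:E.
have F0 h w : (0 <= F h w)%E.
  by rewrite /F; case: eqP => // _; rewrite lee_fin mulr_ge0 ?decays_ge0.
apply: (@le_trans _ _ (\int[P]_w (\esum_(h in [set: s.-tuple int]) F h w))%E).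
  apply: le_integral_nonmeasurable => w; first by rewrite sqre_ge0.
  apply: (le_trans (wce_sqr_le _ _ N0 g0)); rewrite esum_mkcond; apply: le_esum => h _.
  rewrite /F; case: ifPn => [/set_mem /= /eqP/negbTE ->|]; first by rewrite decayE.
  by move=> _; exact: F0.
rewrite integral_esum//; last first.
  move=> h; rewrite /F; case: eqP => // _.
  by apply/measurable_EFinP; apply: measurable_funM => //; have [] := bounded_mfun_expsum_sqr z X h.
have intF h : (\int[P]_w F h w)%E =
    if h == zero_freq s then 0%E else (decays (2 * alpha) gamma h * mean_weight R N d nat_vector h)%:E.
  rewrite /F; case: eqP => _; first by rewrite integral0.
  have be := bounded_mfun_expsum_sqr z X h.
  by rewrite (bounded_mfun_integral P (bounded_mfunM (bounded_mfun_cst T _) be)) bounded_mfun_RintegralZl// mean_expsum_sqr_weight.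
under eq_esum do rewrite intF.
have W0 (h : s.-tuple int) : 0 <= decays (2 * alpha) gamma h * mean_weight R N d nat_vector h.
  by rewrite mulr_ge0 ?decays_ge0 ?mean_weight_ge0.
have := esum_mean_weight N nat_vector a1 g0' ds.
rewrite (esumID [set zero_freq s]); last by move=> h _; rewrite lee_fin.
set S := \esum_(i in _ `&` ~` _) _.
have -> : \esum_(i in [set: s.-tuple int] `&` [set zero_freq s])
    (decays (2 * alpha) gamma i * mean_weight R N d nat_vector i)%:E = 1%E.
  by rewrite setTI esum_set1 ?lee_fin// decays_zero mean_weight_zero mulr1.
have <- : S = \esum_(h in [set: s.-tuple int])
   (if h == zero_freq s then 0%E else (decays (2 * alpha) gamma h * mean_weight R N d nat_vector h)%:E).
  rewrite /S setTI esum_mkcond; apply: eq_esum => h _.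
  have [->|h0] := eqVneq h (zero_freq s); first by rewrite memNset//= => /(_ erefl).
  by rewrite mem_set//; exact/eqP.
(* Finiteness of the dual sum allows solving the identity for [S], the 1 being the contribution of
   the zero frequency. *)
have := dual_sum_fin N a1 g0' d nat_vector; case: dual_sum => // D _.
case: S => // x; rewrite -!EFinD => -[e]; rewrite lee_fin.
by rewrite le_eqVlt; apply/orP; left; apply/eqP; rewrite addrAC -e addrAC subrr add0r.
Qed.

End mean_wce.

(** * Weights and final bounds *)

Section bounds.
Variable R : realType.

Lemma prod_1D_le_expR (m n : nat) (u : nat -> R) (S : R) : (forall j, 0 <= u j) ->
  \sum_(m <= j < n) u j <= S -> \prod_(m <= j < n) (1 + u j) <= expR S.
Proof.
move=> u0 uS; apply: (@le_trans _ _ (expR (\sum_(m <= j < n) u j))); last by rewrite ler_expR.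
suff /andP[] : 0 <= \prod_(m <= j < n) (1 + u j) <= expR (\sum_(m <= j < n) u j) by [].
elim/big_rec2: _ => [|j x y _ /andP[y0 yx]]; first by rewrite expR0 ler01 lexx.
by rewrite mulr_ge0 ?addr_ge0//= expRD ler_pM ?expR_ge1Dx ?addr_ge0.
Qed.

Lemma sum_le_zeta (u : nat -> R) (c p : R) n : 1 < p -> 0 <= c ->
  (forall j, u j <= c * j.+1%:R `^ (- p)) -> \sum_(0 <= j < n) u j <= c * zeta p.
Proof.
move=> p1 c0 uc; apply: le_trans (ler_sum_nat (fun j _ => uc j)) _.
by rewrite -mulr_sumr ler_wpM2l// series_le_zeta.
Qed.

(* Convexity of the exponential between [0] and [y]. *)
Lemma expR_scale_le (y t : R) : 0 <= t <= 1 -> -1 + expR (y * t) <= t * (-1 + expR y).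
Proof.
move=> /andP[t0 t1].
have E0 : 0 <= expR (y * t) by exact: expR_ge0.
have H1 : expR (y * t) * (1 + y * (1 - t)) <= expR y.
  have -> : expR y = expR (y * t) * expR (y * (1 - t)) by rewrite -expRD; congr expR; ring.
  by rewrite ler_wpM2l// expR_ge1Dx.
have H2 : expR (y * t) * (1 - y * t) <= 1.
  rewrite -[leRHS](expR0) -(subrr (y * t)) expRD ler_wpM2l//.
  exact: expR_ge1Dx.
have H3 := ler_wpM2l t0 H1.
have t1' : 0 <= 1 - t by rewrite subr_ge0.
have H4 := ler_wpM2l t1' H2.
rewrite -subr_ge0.
have -> : t * (-1 + expR y) - (-1 + expR (y * t)) =
   (t * expR y - t * (expR (y * t) * (1 + y * (1 - t)))) +
   ((1 - t) * 1 - (1 - t) * (expR (y * t) * (1 - y * t))) by ring.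
by rewrite addr_ge0// subr_ge0.
Qed.

(** By monotonicity, [j + 1] times [gamma j ^ l] is at most the sum of the first [j + 1] terms,
    hence at most the full sum [S]; the constant is [S ^ (1 / l)]. *)
Lemma weight_decay (gamma : nat -> R) (l : R) : 0 < l ->
  (forall j, 0 < gamma j) -> nonincreasing_seq gamma ->
  cvgn (series (fun j => gamma j `^ l)) ->
  exists2 C, 0 < C & forall j, gamma j <= C * j.+1%:R `^ (- (1 / l)).
Proof.
move=> l0 g0 gN gc; set S := limn (series (fun j => gamma j `^ l)).
have nd : nondecreasing_seq (series (fun j => gamma j `^ l)).
  by apply: nondecreasing_series => n _ _; exact: powR_ge0.
have leS n : \sum_(0 <= j < n) gamma j `^ l <= S by exact: (nondecreasing_cvgn_le nd gc n).
have S0 : 0 < S.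
  by apply: (lt_le_trans _ (leS 1%N)); rewrite big_nat1 powR_gt0.
exists (S `^ (1 / l)); first exact: powR_gt0.
move=> j; have H : gamma j `^ l <= S / j.+1%:R.
  rewrite ler_pdivlMr ?ltr0n//; apply: le_trans (leS j.+1).
  rewrite mulr_natr -[X in _ *+ X]subn0 -sumr_const_nat; apply: ler_sum_nat => i ij.
  by apply: ge0_ler_powR; rewrite ?nnegrE ?(ltW l0) ?(ltW (g0 _))//; apply: gN.
have -> : gamma j = (gamma j `^ l) `^ (1 / l).
  by rewrite -powRrM div1r mulfV ?gt_eqF// powRr1// ltW.
apply: (@le_trans _ _ ((S / j.+1%:R) `^ (1 / l))).
  by apply: ge0_ler_powR; rewrite ?nnegrE ?powR_ge0 ?divr_ge0 ?(ltW l0) ?(ltW S0).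
by rewrite powRM ?invr_ge0 ?(ltW S0)// -[X in _ * X `^ _ <= _]powR_inv1// -powRrM mulN1r.
Qed.

End bounds.

(** * From the output of the algorithm to the final bound *)

Section assembly.
Variables (R : realType) (gamma : nat -> R).
Hypothesis g0 : forall j, 0 < gamma j.

Lemma nat_vector_ord d (z : 'I_d -> nat) (j : 'I_d) : nat_vector z j = z j.
Proof.
rewrite /nat_vector; case: insubP => [i _ ij|]; last by rewrite ltn_ord.
by congr z; apply: val_inj.
Qed.

(** In dimension one [N] divides [k * w] exactly when it divides [k], for any unit [w]; thus the
    prescribed first component 1 does as well as every unit. *)
Lemma dual_incr_coprime0 N a (z : nat -> nat) w : coprime N w ->
  dual_incr N a gamma 0 z 1 = dual_incr N a gamma 0 z w.
Proof.
move=> cw; apply: eq_esum => h _; congr esum.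
rewrite /nz_sols /int_dot big_ord0; congr (_ `&` _); apply/seteqP; split=> k /=;
  rewrite !add0r mulr1 !dvdzE abszM /= Gauss_dvdl//.
Qed.

(** The candidates [z j] and [w] share their prefix, whose dual sum is finite and cancels; comparing
    errors thus amounts to comparing increments. *)
Lemma cbc_dual_incr_le alpha N d (z : 'I_d -> nat) : 1 / 2 < alpha -> (1 < N)%N ->
  cbc_vector alpha gamma N z ->
  forall j w, (j < d)%N -> (w < N)%N -> coprime N w ->
  (dual_incr N (2 * alpha) gamma j (nat_vector z) (nat_vector z j) <=
   dual_incr N (2 * alpha) gamma j (nat_vector z) w)%E.
Proof.
move=> a2 N1 [zN z1 zmin] j w jd wN cw.
have N0 : (0 < N)%N by exact: ltnW.
have a1 : 1 < 2 * alpha by rewrite mulrC -ltr_pdivrMr.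
have g0' i : 0 <= gamma i by exact/ltW.
case: j jd => [|j] jd.
  have -> : nat_vector z 0 = 1%N by rewrite -(z1 (Ordinal jd))// -nat_vector_ord.
  by rewrite (dual_incr_coprime0 _ _ cw).
(* As [1 < N], a unit is non-zero and so belongs to the range of the algorithm. *)
have w0 : (0 < w)%N by rewrite lt0n; apply: contraTneq cw => ->; rewrite /coprime gcdn0 gtn_eqF.
pose upd v (i : nat) := if i == j.+1 then v else nat_vector z i.
have pref v : @prefix_with d z (Ordinal jd) v = (fun i : 'I_j.+2 => upd v i).
  apply/funext => i; rewrite /prefix_with /upd -val_eqE /=.
  by case: eqP => // _; rewrite -nat_vector_ord.
have := zmin (Ordinal jd) isT w; rewrite w0 wN => /(_ isT).
rewrite !pref !wce_lattice// => H.
have : (dual_sum N (2 * alpha) gamma j.+2 (upd (z (Ordinal jd))) <= dual_sum N (2 * alpha) gamma j.+2 (upd w))%E.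
  by rewrite !dual_sum_split//; apply: leeD.
rewrite ![dual_sum _ _ _ j.+2 _]dual_sumS//.
have uz v i : (i < j.+1)%N -> upd v i = nat_vector z i by move=> ij; rewrite /upd ltn_eqF.
rewrite !(eq_dual_sum _ _ _ (uz _)) !(eq_dual_incr _ _ _ _ (uz _)) leeD2lE ?dual_sum_fin//.
by rewrite /upd eqxx -nat_vector_ord.
Qed.

End assembly.

Theorem theorem4p2 (R : realType) (gamma : nat -> R) (lstar : R)
    (gamma_pos : forall j, 0 < gamma j)
    (gamma_noninc : nonincreasing_seq gamma)
    (lstar01 : 0 < lstar < 1)
    (gamma_summable : cvgn (series (fun j => gamma j `^ lstar))) :
  exists2 C : R, 0 < C &
  forall (N s d : nat) (alpha : R) (z : 'I_d -> nat),
  (0 < N)%N -> (0 < d)%N -> (d < s)%N -> 1 / 2 < alpha ->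
  cbc_vector alpha gamma N z ->
  forall (dT : measure_display) (T : measurableType dT) (P : probability T R)
    (X : 'I_N * 'I_s -> {RV P >-> R}),
  (forall i : 'I_N * 'I_s, (d <= i.2)%N -> uniform01 (X i)) ->
  mutually_independent [set i : 'I_N * 'I_s | (d <= i.2)%N]%SET X ->
  forall lambda : R, Num.max lstar (1 / (2 * alpha)) < lambda -> lambda <= 1 ->
  (\int[P]_w
     worst_case_error alpha gamma
       (concatenated_points z (fun (n : 'I_N) (j : 'I_s) => X (n, j) w)) ^+ 2
   <=
   (((totient N)%:R^-1 *
       (-1 + expR (2 * C `^ lambda * zeta (2 * alpha * lambda) *
                   zeta (lambda / lstar)))) `^ (1 / lambda) +
     expR (2 * C * zeta (2 * alpha) * zeta (1 / lstar)) /
       (N%:R * d%:R `^ (1 / lstar - 1)) *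
       (-1 + expR (2 * C * zeta (2 * alpha) / (1 / lstar - 1))))%:E)%E.
Proof.
have /andP[l0 l1] := lstar01.
have [C C0 gC] := weight_decay l0 gamma_pos gamma_noninc gamma_summable.
exists C => // N s d alpha z N0 d0 ds a2 cbc dT T P X uX indX lambda.
rewrite gt_max => /andP[ll al] lle1.
have g0 j : 0 <= gamma j by exact: ltW.
have a1 : 1 < 2 * alpha by rewrite mulrC -ltr_pdivrMr.
have a0 : 0 < 2 * alpha by rewrite (lt_trans _ a1).
have lam0 : 0 < lambda by rewrite (lt_trans l0).
have al1 : 1 < 2 * alpha * lambda by rewrite mulrC -ltr_pdivrMr.
(* A component strictly between 0 and [N] exists because [0 < d]. *)
have N1 : (1 < N)%N.
  have [/(_ (Ordinal d0)) /andP[z0 zN] _ _] := cbc.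
  exact: leq_ltn_trans z0 zN.
have M := mean_wce_le z N0 (ltnW ds) uX indX a2 gamma_pos.
apply: le_trans M _.
rewrite EFinD; apply: leeD.
  have lam01 : 0 < lambda <= 1 by rewrite lam0.
  have := cbc_dual_sum_le N0 a1 g0 lam01 al1 (cbc_dual_incr_le gamma_pos a2 N1 cbc).
  have := dual_sum_fin N a1 g0 d (nat_vector z).
  case: (dual_sum _ _ _ _ _) => // D _; rewrite -EFinB !lee_fin -lerBlDl => H.
  apply: (le_trans H); have zge0 := zeta_ge0 al1.
  have u0 j : 0 <= 2 * gamma j `^ lambda * zeta (2 * alpha * lambda).
    by rewrite mulr_ge0// mulr_ge0// powR_ge0.
  have p1 : 1 <= \prod_(j < d) (1 + 2 * gamma j `^ lambda * zeta (2 * alpha * lambda)).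
    by elim/big_rec: _ => // i x _ x1; rewrite mulr_ege1// lerDl.
  have pe : \prod_(j < d) (1 + 2 * gamma j `^ lambda * zeta (2 * alpha * lambda)) <=
      expR (2 * C `^ lambda * zeta (2 * alpha * lambda) * zeta (lambda / lstar)).
    rewrite -(big_mkord xpredT (fun j => 1 + 2 * gamma j `^ lambda * zeta (2 * alpha * lambda))).
    (* The [lambda]-th powers of the weights decay with exponent [lambda / lstar], above 1 since
       [lstar < lambda]. *)
    apply: prod_1D_le_expR => //; apply: sum_le_zeta.
    - by rewrite ltr_pdivlMr// mul1r.
    - by rewrite mulr_ge0// mulr_ge0// powR_ge0.
    move=> j; have gl : gamma j `^ lambda <= C `^ lambda * j.+1%:R `^ (- (lambda / lstar)).
      have -> : - (lambda / lstar) = - (1 / lstar) * lambda by rewrite div1r mulNr mulrC.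
      rewrite powRrM -powRM ?powR_ge0 ?(ltW C0)//.
      by apply: ge0_ler_powR; rewrite ?nnegrE ?(ltW lam0) ?g0 ?mulr_ge0 ?powR_ge0 ?(ltW C0).
    rewrite (mulrAC (2 * _)) ler_wpM2r//; first by rewrite -mulrA ler_wpM2l.
  have phi0 : 0 <= (totient N)%:R^-1 :> R by rewrite invr_ge0.
  apply: ge0_ler_powR;
    rewrite ?nnegrE ?mulr_ge0 ?divr_ge0 ?(ltW lam0) ?(addrC (- 1)) ?subr_ge0 ?invr_ge0 ?(ltW lam0)//.
    exact: le_trans p1 pe.
  by rewrite ler_wpM2l// lerD2r.
have p1 : 1 < 1 / lstar by rewrite ltr_pdivlMr// mul1r.
have z0 := zeta_ge0 a1.
pose u j := 2 * gamma j * zeta (2 * alpha); pose c := 2 * C * zeta (2 * alpha).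
have c0 : 0 <= c by rewrite mulr_ge0// mulr_ge0// ltW.
have u0 j : 0 <= u j by rewrite mulr_ge0// mulr_ge0.
have uc j : u j <= c * j.+1%:R `^ (- (1 / lstar)).
  by rewrite /u /c (mulrAC (2 * C)) ler_wpM2r// -mulrA ler_wpM2l.
have d0R : 0 < d%:R :> R by rewrite ltr0n.
(* The factor [1 / d ^ (1 / lstar - 1)] of the bound, at most 1 because [1 < 1 / lstar]. *)
pose t : R := d%:R `^ (1 - 1 / lstar).
have tE : t = (d%:R `^ (1 / lstar - 1))^-1 by rewrite /t -powRN opprB.
have t01 : 0 <= t <= 1.
  rewrite powR_ge0/= tE invf_le1 ?powR_gt0// -[leLHS](powRr0 d%:R).
  by rewrite ler_powR ?ler1n// subr_ge0 ltW.
rewrite lee_fin -(big_mkord xpredT (fun j => 1 + u j)) -(big_mkord xpredT (fun j => 1 + u j)).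
(* Splitting the product at [d] factors the difference as the first part times the tail product
   minus 1. *)
rewrite (@big_cat_nat _ _ _ d)//=; last exact: ltnW.
rewrite -[X in _ - X]mulr1 -mulrBr.
have H1 : \prod_(0 <= j < d) (1 + u j) <= expR (c * zeta (1 / lstar)).
  by apply: prod_1D_le_expR => //; exact: sum_le_zeta.
(* The weights from index [d] on sum to at most [t] times [c / (1 / lstar - 1)], and [expR_scale_le]
   takes [t] out of the exponent. *)
have H2 : -1 + \prod_(d <= j < s) (1 + u j) <= t * (-1 + expR (c / (1 / lstar - 1))).
  apply: le_trans (expR_scale_le _ t01); rewrite lerD2l; apply: prod_1D_le_expR => //.
  apply: le_trans (ler_sum_nat (fun j _ => uc j)) _.
  have := ler_wpM2l c0 (sum_powR_tail s p1 d0).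
  by rewrite mulr_sumr mulrA mulrAC.
have -> : expR (2 * C * zeta (2 * alpha) * zeta (1 / lstar)) / (N%:R * d%:R `^ (1 / lstar - 1)) *
    (-1 + expR (2 * C * zeta (2 * alpha) / (1 / lstar - 1))) =
    N%:R^-1 * (expR (c * zeta (1 / lstar)) * (t * (-1 + expR (c / (1 / lstar - 1))))).
  by rewrite invfM -tE /c; ring.
rewrite ler_wpM2l ?invr_ge0// ler_pM//.
- by apply: prodr_ge0 => j _; rewrite addr_ge0.
- by rewrite subr_ge0; elim/big_rec: _ => // j x _ x1; rewrite mulr_ege1// lerDl.
- by rewrite addrC.
Qed.
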